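(* Let $\sigma\in S_n$. The graded character of $\mathfrak{pfb}_n^!$ evaluated at $\sigma$ is $$\mathfrak{pfb}^!_{n,\sigma}(z)=\sum_{S}\ \prod_{i=1}^r\Big[\sum_{k_i}\epsilon_{k_i}\,k_i^{(|S_i|-1)}\,z^{k_i\left(\sum_{\tau\in S_i}d_\tau-1\right)}\Big],$$ where (i) the first sum is over the unordered partitions $S=S_1\sqcup\dots\sqcup S_r$ of the set of cycles in the cycle decomposition of $\sigma$ (fixed points counted as cycles of length 1) into unordered (non-empty) subsets; (ii) the inner sum is over integers $k_i\ge1$ which divide the orders (lengths) of all cycles belonging to $S_i$, that is, such that there exist integers $d_\tau\ge1$ with $k_id_\tau=|V(\tau)|$ for all cycles $\tau\in S_i$, where $V(\tau)$ is the set of indices of the cycle $\tau$; (iii) $\epsilon_{k_i}=(-1)^{(k_i-1)\left(\sum_{\tau\in S_i}d_\tau-1\right)+\sum_{\tau\in S_i}(d_\tau-1)}$. (In the exponents, $\sum_{\tau\in S_i}d_\tau-1$ means $\big(\sum_{\tau\in S_i}d_\tau\big)-1$.)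
   Context: $\mathfrak{pfb}_n^!$ is the exterior algebra over $\mathbb{Q}$ on degree-1 generators $r_{ij}$, $1\le i\ne j\le n$, with $r_{ij}=-r_{ji}$, modulo the relations $r_{ij}\wedge r_{ik}=r_{ij}\wedge r_{jk}$ and $r_{ik}\wedge r_{jk}=r_{ij}\wedge r_{jk}$ for all $i<j<k$. (It is known to be isomorphic to the rational cohomology algebra of the pure flat braid group $PfB_n$.) $S_n$ acts on it by $\sigma(r_{ij})=r_{\sigma(i)\sigma(j)}$. $\mathfrak{pfb}^!_{n,\sigma}(z)=\sum_{k\ge0}(\text{trace of }\sigma\text{ on the degree-}k\text{ component of }\mathfrak{pfb}_n^!)\,z^k$. *)

(* Defs.v *)
From HB Require Import structures.
From mathcomp Require Import all_boot all_order all_algebra all_fingroup.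
From mathcomp Require Import mxrepresentation finmap monalg.

Set Implicit Arguments.
Unset Strict Implicit.
Unset Printing Implicit Defensive.

Import GRing.Theory.

Local Open Scope ring_scope.

(* A graded algebra is given by a presentation: the free associative          *)
(* Q-algebra on a finite set G of degree-1 generators, modulo the two-sided   *)
(* ideal generated by a finite list R of homogeneous relators. Words in G are *)
(* the monomials of the free algebra.                                         *)
Notation free_alg G := {malg rat[{fmonom G}]}.

Section Presentation.
Variable G : finType.

Definition word (w : seq G) : free_alg G := << FMonom w >>.

Lemma word_cat u v : word (u ++ v) = word u * word v.
Proof.
rewrite /word malgM_def fgmulUU mul1r; congr (<< _ *g _ >>).
by apply/eqP; rewrite fmP fmM.
Qed.

Lemma word_nil : word [::] = 1.
Proof.
rewrite /word -mpolyC1E; congr (<< _ *g _ >>).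
by apply/eqP; rewrite fmP fm1.
Qed.

Lemma malgUE (c : rat) (m : {fmonom G}) : << c *g m >> = c *: << m >> :> free_alg G.
Proof. by apply/malgP => m'; rewrite [RHS]mcoeffZ 2!mcoeffU mulr_natr. Qed.

Lemma free_algE (x : free_alg G) :
  x = \sum_(m <- msupp x) x@_m *: word (fmonom_val m).
Proof.
rewrite {1}[x]monalgE; apply: eq_bigr => m _; rewrite /word fmK.
exact: malgUE.
Qed.

Lemma free_scalerAr c (x y : free_alg G) : x * (c *: y) = c *: (x * y).
Proof.
apply/malgP => m; rewrite [RHS]mcoeffZ.
apply: etrans (mcoeffMlw m (fsubset_refl (msupp x)) (msuppZ_le c y)) _.
apply: etrans (congr1 ( *%R c) (esym (mcoeffMl x y m))); rewrite mulr_sumr.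
by apply: eq_bigr => k1 _; rewrite mulr_sumr; apply: eq_bigr => k2 _;
   rewrite mcoeffZ mulrCA mulrnAr.
Qed.

(* Inductive closure: with u = v = 1 it contains every relator, and it is     *)
(* stable under both multiplications by distributivity.                       *)
Inductive ideal (R : seq (free_alg G)) : free_alg G -> Prop :=
| Ideal0 : ideal R 0
| IdealD x y : ideal R x -> ideal R y -> ideal R (x + y)
| IdealM u rho v : rho \in R -> ideal R (u * rho * v).

Lemma ideal_gen R rho : rho \in R -> ideal R rho.
Proof. by move=> h; rewrite -[rho]mul1r -[_ * _]mulr1; apply: IdealM. Qed.

Lemma idealMl R a x : ideal R x -> ideal R (a * x).
Proof.
elim=> [|y z _ iy _ iz|u rho v h]; first by rewrite mulr0; apply: Ideal0.
  by rewrite mulrDr; apply: IdealD.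
by rewrite !mulrA; apply: IdealM.
Qed.

Lemma idealMr R a x : ideal R x -> ideal R (x * a).
Proof.
elim=> [|y z _ iy _ iz|u rho v h]; first by rewrite mul0r; apply: Ideal0.
  by rewrite mulrDl; apply: IdealD.
by rewrite -mulrA; apply: IdealM.
Qed.

Lemma idealN R x : ideal R x -> ideal R (- x).
Proof. by rewrite -mulN1r; apply: idealMl. Qed.

Lemma idealZ R c x : ideal R x -> ideal R (c *: x).
Proof. by rewrite -mul_malgC; apply: idealMl. Qed.

(* The degree-k component of the free algebra, in the basis of words of       *)
(* length k; [coord k] also projects onto that component.                     *)
Definition hdim (k : nat) : nat := #|{: k.-tuple G}|.

Definition coord (k : nat) (x : free_alg G) : 'rV[rat]_(hdim k) :=
  \row_(i < hdim k) x@_(FMonom (enum_val i)).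

Fact coord_is_linear k : linear (coord k).
Proof. by move=> c x y; apply/rowP => i; rewrite !mxE mcoeffD mcoeffZ. Qed.
HB.instance Definition _ k :=
  GRing.isLinear.Build rat (free_alg G) 'rV[rat]_(hdim k) *:%R (coord k)
    (coord_is_linear k).

(* The degree-k component of the ideal: as the relators are homogeneous, it   *)
(* is the projection of the ideal (see ideal_mxP), hence spanned by the       *)
(* projections of u * rho * v for words u, v of length at most k.             *)
Definition ideal_mx (R : seq (free_alg G)) (k : nat) : 'M[rat]_(hdim k) :=
  (\sum_(a < k.+1) \sum_(b < k.+1)
     \sum_(u : a.-tuple G) \sum_(v : b.-tuple G) \sum_(rho <- R)
       <<coord k (word u * rho * word v)%R>>)%MS.

Lemma coord_gt0 k (u v : seq G) rho :
  (k < size u)%N || (k < size v)%N -> coord k (word u * rho * word v) = 0.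
Proof.
move=> lt_k; rewrite [rho]free_algE mulr_sumr mulr_suml linear_sum big1 // => m _.
rewrite free_scalerAr -scalerAl linearZ -!word_cat.
apply/rowP => i; rewrite !mxE mcoeffU1 fmP /=.
case: eqP => [e|_]; last by rewrite mulr0.
have := congr1 size e; rewrite size_tuple !size_cat => ek.
by move: lt_k; rewrite -ek -!addnA ltnNge leq_addr ltnNge addnA leq_addl.
Qed.

Lemma coord_sub_ideal_mx R k (u v : seq G) rho :
  rho \in R -> (coord k (word u * rho * word v) <= ideal_mx R k)%MS.
Proof.
move=> hR; case: (boolP ((k < size u)%N || (k < size v)%N)) => [lt_k|].
  by rewrite coord_gt0 // sub0mx.
rewrite negb_or -!leqNgt => /andP[ku kv].
rewrite /ideal_mx.
apply: (submx_trans _ (sumsmx_sup (Ordinal (ku : (size u < k.+1)%N)) isT (submx_refl _))).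
apply: (submx_trans _ (sumsmx_sup (Ordinal (kv : (size v < k.+1)%N)) isT (submx_refl _))).
apply: (submx_trans _ (sumsmx_sup (in_tuple u) isT (submx_refl _))).
apply: (submx_trans _ (sumsmx_sup (in_tuple v) isT (submx_refl _))).
rewrite (big_rem rho) //=; apply: submx_trans (addsmxSl _ _).
by rewrite genmxE.
Qed.

Lemma ideal_sub_mx R k x : ideal R x -> (coord k x <= ideal_mx R k)%MS.
Proof.
elim=> [|y z _ iy _ iz|a rho b h].
- by rewrite linear0 sub0mx.
- by rewrite linearD addmx_sub.
rewrite [a]free_algE [b]free_algE [_ * rho]mulr_suml [_ * (\sum_(i <- _) _)]mulr_suml linear_sum summx_sub // => m _.
rewrite mulr_sumr linear_sum summx_sub // => m' _.
rewrite -2!scalerAl free_scalerAr 2!linearZ !scalemx_sub //.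
exact: coord_sub_ideal_mx.
Qed.

Lemma ideal_mxP R k (w : 'rV[rat]_(hdim k)) :
  (w <= ideal_mx R k)%MS <-> exists2 x, ideal R x & coord k x = w.
Proof.
split=> [|[x ix <-]]; last exact: ideal_sub_mx.
pose P (M : 'M[rat]_(hdim k)) := forall w' : 'rV_(hdim k), (w' <= M)%MS ->
  exists2 x, ideal R x & coord k x = w'.
suff: P (ideal_mx R k) by apply.
have P0 : P 0.
  move=> w'; rewrite submx0 => /eqP->; exists 0; first exact: Ideal0.
  by rewrite linear0.
have PD A B : P A -> P B -> P (A + B)%MS.
  move=> PA PB w' /sub_addsmxP[[c d] /= ->].
  have [x ix ex] := PA (c *m A) (submxMl _ _).
  have [y iy ey] := PB (d *m B) (submxMl _ _).
  by exists (x + y); [apply: IdealD | rewrite linearD /= ex ey].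
rewrite /ideal_mx.
apply: (big_ind P) => // a _; apply: (big_ind P) => // b _.
apply: (big_ind P) => // u _; apply: (big_ind P) => // v _.
rewrite big_seq; apply: (big_ind P) => // rho hR w'.
rewrite genmxE => /sub_rVP[c ->].
exists (c *: (word u * rho * word v)); last by rewrite linearZ.
by apply: idealZ; apply: IdealM.
Qed.

Section Functor.
Variable f : G -> G.

Definition map_word (w : {fmonom G}) : free_alg G := word (map f w).

Fact map_word_mmorphism : mmorphism map_word.
Proof.
split=> [u v|]; rewrite /map_word; first by rewrite fmM map_cat word_cat.
by rewrite fm1 word_nil.
Qed.
HB.instance Definition _ :=
  isMultiplicative.Build {fmonom G} (free_alg G) map_word map_word_mmorphism.

Definition free_map (x : free_alg G) : free_alg G := mmap (@malgC {fmonom G} rat) map_word x.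

Lemma free_mapD x y : free_map (x + y) = free_map x + free_map y.
Proof. exact: mmapD. Qed.

Lemma free_mapB x y : free_map (x - y) = free_map x - free_map y.
Proof. exact: mmapB. Qed.

Lemma free_map0 : free_map 0 = 0.
Proof. exact: mmap0. Qed.

Lemma free_mapM x y : free_map (x * y) = free_map x * free_map y.
Proof.
apply: (commr_mmap_is_multiplicative _).1 => g m m'.
have E (c : rat) : mkmalgU mone c = c *: 1 :> free_alg G := malgUE c mone.
by rewrite /GRing.comm mul_malgC /= E free_scalerAr mulr1.
Qed.

Lemma free_map_word w : free_map (word w) = word (map f w).
Proof. by rewrite /free_map /word mmapU /= mpolyC1E mul1r. Qed.

Lemma free_mapMw u v : free_map (word u * word v) = word (map f u) * word (map f v).
Proof. by rewrite free_mapM (free_map_word u) (free_map_word v). Qed.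

Lemma free_map_anti u v :
  free_map (word u * word v + word v * word u)
    = word (map f u) * word (map f v) + word (map f v) * word (map f u).
Proof. exact: etrans (free_mapD _ _) (congr2 +%R (free_mapMw u v) (free_mapMw v u)). Qed.

Lemma free_mapZ c x : free_map (c *: x) = c *: free_map x.
Proof. by rewrite /free_map mmapZ mul_malgC. Qed.

Lemma free_map_sum I (r : seq I) (F : I -> (free_alg G)) :
  free_map (\sum_(i <- r) F i) = \sum_(i <- r) free_map (F i).
Proof. exact: (big_morph _ free_mapD free_map0). Qed.

Lemma ideal_free_map R :
  {in R, forall rho, ideal R (free_map rho)} ->
  forall x, ideal R x -> ideal R (free_map x).
Proof.
move=> hR x; elim=> [|y z _ iy _ iz|u rho v h].
- by rewrite free_map0; apply: Ideal0.
- by rewrite free_mapD; apply: IdealD.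
by rewrite !free_mapM; apply: idealMr; apply: idealMl; apply: hR.
Qed.

Definition word_mx (k : nat) : 'M[rat]_(hdim k) :=
  \matrix_(i, j) (enum_val j == map_tuple f (enum_val i))%:R.

Lemma coord_free_map k x : coord k (free_map x) = coord k x *m word_mx k.
Proof.
rewrite [x]free_algE free_map_sum !linear_sum mulmx_suml; apply: eq_bigr => m _.
rewrite free_mapZ !linearZ /= -scalemxAl; congr (_ *: _).
rewrite free_map_word; apply/rowP => j; rewrite !mxE mcoeffU1 fmP /=.
case: (boolP (size m == k)) => [szm|nszm].
  pose t := Tuple szm; rewrite (bigD1 (enum_rank t)) //= big1 ?addr0.
    by rewrite !mxE mcoeffU1 enum_rankK fmP eqxx mul1r -val_eqE eq_sym.
  move=> i nit; rewrite !mxE mcoeffU1 fmP /=; case: eqP => [e|_]; last by rewrite mul0r.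
  case/eqP: nit; apply: enum_val_inj; rewrite enum_rankK.
  by apply: val_inj; rewrite /= -e.
rewrite big1 => [|i _].
  case: eqP => // e; case/eqP: nszm.
  by rewrite -(size_map f) e size_tuple.
rewrite !mxE mcoeffU1 fmP /=; case: eqP => [e|_]; last by rewrite mul0r.
by case/eqP: nszm; rewrite e size_tuple.
Qed.

End Functor.
End Presentation.

Section PureFlatBraid.
Variable n : nat.

Definition gen : finType := {p : 'I_n * 'I_n | p.1 != p.2}.

(* rgen i j is the generator r_ij for i != j; rgen i i is set to 0.           *)
Definition rgen (i j : 'I_n) : free_alg gen :=
  if insub (i, j) is Some g then word [:: g] else 0.

Definition triples : seq ('I_n * 'I_n * 'I_n) :=
  [seq t : 'I_n * 'I_n * 'I_n <- enum {: 'I_n * 'I_n * 'I_n}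
     | (t.1.1 < t.1.2 < t.2)%N].

(* Antisymmetry of rgen; the squares and anticommutators of the generators,   *)
(* which span the squares v * v of all linear combinations v and so define    *)
(* the exterior algebra as a quotient of the tensor algebra; and, for         *)
(* i < j < k, the two families of quadratic relations.                        *)
Definition pfb_relators : seq (free_alg gen) :=
  [seq rgen i j + rgen j i | i <- enum 'I_n, j <- enum 'I_n] ++
  [seq word [:: x] * word [:: x] | x <- enum {: gen}] ++
  [seq word [:: x] * word [:: y] + word [:: y] * word [:: x]
     | x <- enum {: gen}, y <- enum {: gen}] ++
  [seq (let: (i, j, k) := t in rgen i j * rgen i k - rgen i j * rgen j k)
     | t <- triples] ++
  [seq (let: (i, j, k) := t in rgen i k * rgen j k - rgen i j * rgen j k)
     | t <- triples].

Local Notation Ipfb := (ideal pfb_relators).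

Lemma relator_asym i j : Ipfb (rgen i j + rgen j i).
Proof.
apply: ideal_gen; rewrite mem_cat; apply/orP; left.
by apply: allpairs_f; rewrite mem_enum.
Qed.

Lemma relator_sqr (x : gen) : Ipfb (word [:: x] * word [:: x]).
Proof.
apply: ideal_gen; rewrite !mem_cat; apply/or4P; apply: Or42.
by apply/mapP; exists x => //; rewrite mem_enum.
Qed.

Lemma relator_anti (x y : gen) :
  Ipfb (word [:: x] * word [:: y] + word [:: y] * word [:: x]).
Proof.
apply: ideal_gen; rewrite !mem_cat; apply/or4P; apply: Or43.
by apply: allpairs_f; rewrite mem_enum.
Qed.

Lemma r_anti i j k l : Ipfb (rgen i j * rgen k l + rgen k l * rgen i j).
Proof.
rewrite /rgen; case: insubP => [x _ _|_]; last by rewrite mul0r mulr0 addr0; apply: Ideal0.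
case: insubP => [y _ _|_]; last by rewrite mul0r mulr0 addr0; apply: Ideal0.
exact: relator_anti.
Qed.

Definition cong (x y : free_alg gen) := Ipfb (x - y).

Lemma cong_sym x y : cong x y -> cong y x.
Proof. by move/idealN; rewrite opprB. Qed.

Lemma cong_trans y x z : cong x y -> cong y z -> cong x z.
Proof. by move=> h /(IdealD h); rewrite subrKA. Qed.

Lemma congN x y : cong x y -> cong (- x) (- y).
Proof. by rewrite /cong => /idealN; rewrite opprB opprK addrC. Qed.

Lemma congMl a x y : cong x y -> cong (a * x) (a * y).
Proof. by rewrite /cong => /(idealMl a); rewrite mulrBr. Qed.

Lemma congMr a x y : cong x y -> cong (x * a) (y * a).
Proof. by rewrite /cong => /(idealMr a); rewrite mulrBl. Qed.

Lemma r_asymE i j : cong (rgen i j) (- rgen j i).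
Proof. by rewrite /cong opprK; apply: relator_asym. Qed.

Lemma r_antiE i j k l : cong (rgen i j * rgen k l) (- (rgen k l * rgen i j)).
Proof. by rewrite /cong opprK; apply: r_anti. Qed.

Definition triangle i j k :=
  cong (rgen i j * rgen i k) (rgen i j * rgen j k) /\
  cong (rgen i k * rgen j k) (rgen i j * rgen j k).

Lemma triangle_swap12 i j k : triangle i j k -> triangle j i k.
Proof.
case=> h1 h2.
have h : cong (- (rgen i j * rgen i k)) (rgen j i * rgen i k).
  by apply: cong_sym; rewrite -mulNr; apply/congMr/r_asymE.
split.
  apply: cong_trans h; apply: (@cong_trans (- (rgen i j * rgen j k))).
    by rewrite -mulNr; apply/congMr/r_asymE.
  exact/congN/cong_sym.
apply: cong_trans h; apply: cong_trans (r_antiE _ _ _ _) _; apply: congN.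
exact: cong_trans h2 (cong_sym h1).
Qed.

Lemma triangle_swap23 i j k : triangle i j k -> triangle i k j.
Proof.
case=> h1 h2.
have h : cong (- (rgen i k * rgen j k)) (rgen i k * rgen k j).
  by apply: cong_sym; rewrite -mulrN; apply/congMl/r_asymE.
split; apply: cong_trans h.
  apply: cong_trans (r_antiE _ _ _ _) _; apply: congN.
  exact: cong_trans h1 (cong_sym h2).
apply: (@cong_trans (- (rgen i j * rgen j k))).
  by rewrite -mulrN; apply/congMl/r_asymE.
exact/congN/cong_sym.
Qed.

Lemma triangle_lt (i j k : 'I_n) : (i < j < k)%N -> triangle i j k.
Proof.
move=> lt_ijk; split; apply: ideal_gen; rewrite !mem_cat.
  apply/or4P; apply: Or44; apply/orP; left.
  by apply/mapP; exists (i, j, k); rewrite // mem_filter mem_enum lt_ijk.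
apply/or4P; apply: Or44; apply/orP; right.
by apply/mapP; exists (i, j, k); rewrite // mem_filter mem_enum lt_ijk.
Qed.

Lemma triangle_neq (i j k : 'I_n) :
  i != j -> i != k -> j != k -> triangle i j k.
Proof.
move=> nij nik njk.
have [lij|lji|/val_inj e] := ltngtP i j; last by rewrite e eqxx in nij.
- have [ljk|lkj|/val_inj e] := ltngtP j k; last by rewrite e eqxx in njk.
    by apply: triangle_lt; rewrite lij ljk.
  apply: triangle_swap23.
  have [lik|lki|/val_inj e] := ltngtP i k; last by rewrite e eqxx in nik.
    by apply: triangle_lt; rewrite lik lkj.
  by apply: triangle_swap12; apply: triangle_lt; rewrite lki lij.
- apply: triangle_swap12.
  have [lik|lki|/val_inj e] := ltngtP i k; last by rewrite e eqxx in nik.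
    by apply: triangle_lt; rewrite lji lik.
  apply: triangle_swap23.
  have [ljk|lkj|/val_inj e] := ltngtP j k; last by rewrite e eqxx in njk.
    by apply: triangle_lt; rewrite ljk lki.
  by apply: triangle_swap12; apply: triangle_lt; rewrite lkj lji.
Qed.

Fact gen_act_subproof (s : 'S_n) (g : gen) :
  s (val g).1 != s (val g).2.
Proof. by rewrite (inj_eq perm_inj); apply: (valP g). Qed.

(* sigma (r_ij) = r_(sigma i)(sigma j) *)
Definition gen_act (s : 'S_n) (g : gen) : gen :=
  exist _ (s (val g).1, s (val g).2) (gen_act_subproof s g).

Lemma free_map_r s i j : free_map (gen_act s) (rgen i j) = rgen (s i) (s j).
Proof.
rewrite /rgen; case: insubP => [g ne e|]; last first.
  rewrite negbK /= => /eqP ->; rewrite free_map0.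
  by case: insubP => // g; rewrite eqxx.
rewrite free_map_word /=; case: insubP => [g' _ e'|]; last first.
  by rewrite /= (inj_eq perm_inj) ne.
by congr (word [:: _]); apply: val_inj; rewrite /= e' e.
Qed.

Lemma free_mapMr s i j k l :
  free_map (gen_act s) (rgen i j * rgen k l) = rgen (s i) (s j) * rgen (s k) (s l).
Proof. by rewrite free_mapM 2!free_map_r. Qed.

Lemma triangle_perm (s : 'S_n) (i j k : 'I_n) :
  (i < j < k)%N -> triangle (s i) (s j) (s k).
Proof.
case/andP=> lij ljk; apply: triangle_neq;
by rewrite (inj_eq perm_inj) -val_eqE neq_ltn ?lij ?ljk ?(ltn_trans lij ljk).
Qed.

Lemma free_map_tri s i j k l i' j' k' l' :
  free_map (gen_act s) (rgen i j * rgen k l - rgen i' j' * rgen k' l')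
    = rgen (s i) (s j) * rgen (s k) (s l) - rgen (s i') (s j') * rgen (s k') (s l').
Proof.
exact: etrans (free_mapB _ _ _)
  (congr2 (fun x y => x - y) (free_mapMr s i j k l) (free_mapMr s i' j' k' l')).
Qed.

Lemma pfb_ideal_stable s x : Ipfb x -> Ipfb (free_map (gen_act s) x).
Proof.
apply: ideal_free_map => rho; rewrite !mem_cat.
case/orP=> [|/or4P[]].
- case/allpairsP=> -[i j] [_ _ ->] /=.
  by rewrite free_mapD !free_map_r; apply: relator_asym.
- by case/mapP=> g _ ->; rewrite free_mapMw; apply: relator_sqr.
- case/allpairsP=> -[x1 x2] [_ _ ->].
  rewrite -[(x1, x2).1]/x1 -[(x1, x2).2]/x2.
  by rewrite free_map_anti; apply: relator_anti.
- case/mapP=> -[[i j] k]; rewrite mem_filter => /andP[ltP _] ->.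
  by rewrite free_map_tri; apply: (triangle_perm s ltP).1.
case/mapP=> -[[i j] k]; rewrite mem_filter => /andP[ltP _] ->.
by rewrite free_map_tri; apply: (triangle_perm s ltP).2.
Qed.

(* Permutations compose from left to right in 'S_n, and matrices act on row   *)
(* vectors from the right, so this is a representation in the sense of        *)
(* mx_representation whose value at s is the linear map induced by s.         *)
Fact word_mx_repr k :
  mx_repr [set: 'S_n] (fun s => word_mx (gen_act s) k).
Proof.
have wM (f : gen -> gen) (i : 'I_(hdim gen k)) :
  delta_mx 0 i *m word_mx f k
    = delta_mx 0 (enum_rank (map_tuple f (enum_val i))) :> 'rV_(hdim gen k).
  rewrite -rowE; apply/rowP => j; rewrite !mxE eqxx /=.
  by rewrite -(inj_eq enum_val_inj) enum_rankK.
split=> [|s t _ _].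
  apply/matrixP => i j; rewrite !mxE -(inj_eq enum_val_inj) eq_sym.
  congr (_ == _)%:R; apply: val_inj => /=.
  rewrite -[RHS]map_id; apply: eq_map => g.
  by apply: val_inj; rewrite /= !perm1; case: (val g).
apply/row_matrixP => i; rewrite row_mul !rowE !wM //; congr (delta_mx _ _).
congr enum_rank; rewrite enum_rankK; apply: val_inj; rewrite /= -map_comp.
by apply: eq_map => g; apply: val_inj; rewrite /= !permM.
Qed.

Definition word_repr k : mx_representation rat [set: 'S_n] (hdim gen k) :=
  MxRepresentation (word_mx_repr k).

Lemma pfb_ideal_module k : mxmodule (word_repr k) (ideal_mx pfb_relators k).
Proof.
apply/mxmoduleP => s _; apply/row_subP => i; rewrite row_mul.
have /ideal_mxP[x ix <-] := row_sub i (ideal_mx pfb_relators k).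
by rewrite -coord_free_map; apply: ideal_sub_mx; apply: pfb_ideal_stable.
Qed.

(* The action of S_n on the degree-k component of the quotient algebra.       *)
Definition pfb_dual_repr k := factmod_repr (pfb_ideal_module k).

Definition pfb_dual_char (s : 'S_n) (k : nat) : rat := \tr (pfb_dual_repr k s).

(* |V(tau)| / k, for a cycle tau represented by its set V(tau) of indices     *)
Definition cycle_quot (k : nat) (tau : {set 'I_n}) : nat := (#|tau| %/ k)%N.

Definition epsilon (B : {set {set 'I_n}}) (k : nat) : rat :=
  (-1) ^+ ((k - 1) * ((\sum_(tau in B) cycle_quot k tau) - 1)
           + \sum_(tau in B) (cycle_quot k tau - 1))%N.

End PureFlatBraid.

Arguments rgen {n}.

(* Main.v *)
Require Import Defs.
From mathcomp Require Import all_boot all_order all_algebra all_fingroup.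
From mathcomp Require Import mxrepresentation finmap monalg zify.

(* Modulo the relations, a monomial in the r_ij depends up to a scalar only   *)
(* on the partition of {1, ..., n} into the connected components of the graph *)
(* of its edges, and it vanishes if that graph has a cycle. Conversely, for   *)
(* a partition pi let V_pi be the span of the vectors e_j - e_i with i, j in  *)
(* the same block; sending r_ij to e_j - e_i maps the degree m component      *)
(* isomorphically onto the direct sum of the lines det(V_pi) over the         *)
(* partitions pi with n - m blocks. A permutation s permutes these lines, and *)
(* it acts on the line of a stable pi by sgn(s) sgn(s | blocks of pi), since  *)
(* Q^n is the sum of V_pi and of the permutation module on the blocks.        *)
(* The trace is therefore a signed count of the s-stable partitions. Grouping *)
(* their blocks into s-orbits yields the partition S of the set of cycles:    *)
(* one orbit, of k blocks, for each part S_i, where k divides the lengths of  *)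
(* the cycles in S_i. Such an orbit is a colouring of the points of S_i by    *)
(* Z/k along which s acts as +1, up to a global shift, hence the factor       *)
(* k ^ (|S_i| - 1).                                                           *)

Set Implicit Arguments.
Unset Strict Implicit.
Unset Printing Implicit Defensive.

Import GRing.Theory Num.Theory.

Local Open Scope ring_scope.

Local Notation coord := Defs.coord.
Local Notation idealMl := Defs.idealMl.
Local Notation idealMr := Defs.idealMr.

(** * Reduction of monomials to star forests *)

Section Spanning.
Variable n : nat.
Implicit Types (s t u v : seq ('I_n * 'I_n)) (f : {ffun 'I_n -> 'I_n}).
Local Notation edge := ('I_n * 'I_n)%type.
Local Notation Ipfb := (ideal (pfb_relators n)).

Definition edge_mon s : free_alg (gen n) := \prod_(e <- s) rgen e.1 e.2.

Lemma edge_mon_cons e s : edge_mon (e :: s) = rgen e.1 e.2 * edge_mon s.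
Proof. by rewrite /edge_mon big_cons. Qed.

Lemma edge_mon_cat s t : edge_mon (s ++ t) = edge_mon s * edge_mon t.
Proof. by rewrite /edge_mon big_cat. Qed.

Lemma cong_refl (x : free_alg (gen n)) : cong x x.
Proof. by rewrite /cong subrr; apply: Ideal0. Qed.

Lemma congZ c (x y : free_alg (gen n)) : cong x y -> cong (c *: x) (c *: y).
Proof. by rewrite /cong => /(idealZ c); rewrite scalerBr. Qed.

Definition reduces s t := exists c : rat, cong (edge_mon s) (c *: edge_mon t).

Lemma reduces_cong s t : cong (edge_mon s) (edge_mon t) -> reduces s t.
Proof. by move=> h; exists 1; rewrite scale1r. Qed.

Lemma reduces_congN s t : cong (edge_mon s) (- edge_mon t) -> reduces s t.
Proof. by move=> h; exists (-1); rewrite scaleN1r. Qed.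

Lemma reduces_refl s : reduces s s.
Proof. exact/reduces_cong/cong_refl. Qed.

Lemma reduces_trans t s u : reduces s t -> reduces t u -> reduces s u.
Proof.
move=> [a st] [b tu]; exists (a * b); apply: cong_trans st _.
by rewrite -scalerA; apply: congZ.
Qed.

Lemma reduces_cons e s t : reduces s t -> reduces (e :: s) (e :: t).
Proof.
move=> [a st]; exists a; rewrite !edge_mon_cons -free_scalerAr.
exact: congMl.
Qed.

Lemma reduces_ideal s t : reduces s t -> Ipfb (edge_mon t) -> Ipfb (edge_mon s).
Proof.
move=> [a st] /(idealZ a) it; rewrite -[edge_mon s](subrK (a *: edge_mon t)).
exact: IdealD.
Qed.

Lemma reduces_flip i j s : reduces ((i, j) :: s) ((j, i) :: s).
Proof.
apply: reduces_congN; rewrite !edge_mon_cons -mulNr.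
exact/congMr/r_asymE.
Qed.

Lemma reduces_swap e1 e2 s : reduces (e1 :: e2 :: s) (e2 :: e1 :: s).
Proof.
apply: reduces_congN; rewrite !edge_mon_cons !mulrA -mulNr.
exact/congMr/r_antiE.
Qed.

Lemma reduces_perm s t : perm_eq s t -> reduces s t.
Proof.
elim: s t => [|e s IHs] t; first by rewrite perm_sym => /perm_nilP->; apply:
  reduces_refl.
move=> est; have /splitPr et: e \in t by rewrite -(perm_mem est) mem_head.
case: et est => t1 t2 est.
have {est}/IHs: perm_eq s (t1 ++ t2).
  by rewrite -(perm_cons e); apply: (perm_trans est); rewrite -cat1s perm_catCA.
move/(reduces_cons e)/reduces_trans; apply.
elim: t1 => [|e1 t1 IHt] /=; first exact: reduces_refl.
exact: reduces_trans (reduces_swap _ _ _) (reduces_cons _ IHt).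
Qed.

Lemma edge_mon_dup e s : e \in s -> Ipfb (edge_mon (e :: s)).
Proof.
move/perm_to_rem/(reduces_perm)/(reduces_cons e)/reduces_ideal; apply.
rewrite !edge_mon_cons mulrA; apply: idealMr; rewrite /rgen.
by case: insubP => [x _ _|_]; [apply: relator_sqr | rewrite mul0r; apply:
  Ideal0].
Qed.

Lemma rgen_diag (i : 'I_n) : rgen i i = 0.
Proof. by rewrite /rgen insubF //= eqxx. Qed.

Lemma reduces_triangle i j p s : i != j -> j != p -> p != i ->
  reduces ((i, j) :: (p, i) :: s) ((p, j) :: (p, i) :: s).
Proof.
move=> nij njp npi; have [tri _] := triangle_neq npi (contra_neq esym njp) nij.
apply: reduces_trans (reduces_swap _ _ _) _.
apply: reduces_trans (reduces_swap _ _ _).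
apply: reduces_cong; rewrite !edge_mon_cons /= !mulrA.
exact/cong_sym/congMr.
Qed.

(* An idempotent f with f x <= x encodes the partition of 'I_n into its       *)
(* fibres, through the function sending x to the least element of its block.  *)
Definition min_rep f := [forall x, (f (f x) == f x) && (f x <= x)%N].

Definition nonroots f := [seq x <- enum 'I_n | f x != x].

Definition star f : seq edge := [seq (f x, x) | x <- nonroots f].

Lemma min_repP f : reflect ((forall x, f (f x) = f x) /\ (forall x, f x <= x)%N)
  (min_rep f).
Proof.
apply: (iffP forallP) => [h|[h1 h2] x]; last by rewrite h1 h2 eqxx.
by split=> x; have /andP[/eqP] := h x.
Qed.

Lemma mem_nonroots f x : (x \in nonroots f) = (f x != x).
Proof. by rewrite mem_filter mem_enum andbT. Qed.

Lemma nonroots_uniq f : uniq (nonroots f).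
Proof. exact/filter_uniq/enum_uniq. Qed.

Lemma mem_star f x : f x != x -> (f x, x) \in star f.
Proof. by move=> nx; apply/mapP; exists x; rewrite ?mem_nonroots. Qed.

Lemma star_slide f i j : min_rep f -> f i != f j ->
  reduces ((i, j) :: star f) ((f i, j) :: star f).
Proof.
move=> /min_repP[ff _] nij; have [->|nfi] := eqVneq (f i) i; first exact:
  reduces_refl.
have fi := mem_star nfi.
have p := reduces_perm (perm_to_rem fi); have p' : perm_eq ((f i, i) ::
  rem (f i, i) (star f)) (star f).
  by rewrite perm_sym perm_to_rem.
apply: reduces_trans (reduces_cons _ p) _.
apply: reduces_trans _ (reduces_cons _ (reduces_perm p')).
apply: reduces_triangle => //; first by apply: contraNneq nij => ->.
by apply: contraNneq nij => ->; rewrite ff.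
Qed.

Lemma star_cycle f i j : min_rep f -> f i = f j -> Ipfb (edge_mon ((i, j) ::
  star f)).
Proof.
move=> mf fij; have [ff _] := min_repP _ mf.
have [->|nij] := eqVneq i j; first by rewrite edge_mon_cons rgen_diag mul0r;
  apply: Ideal0.
have [fi|nfi] := eqVneq (f i) i.
  have nfj : f j != j by rewrite -fij fi.
  by rewrite -fi fij; apply/edge_mon_dup/mem_star.
have [fj|nfj] := eqVneq (f j) j.
  apply: (reduces_ideal (reduces_flip _ _ _)).
  by rewrite -fj -fij; apply/edge_mon_dup/mem_star.
have p := perm_to_rem (mem_star nfi).
apply: (@reduces_ideal _ ((f i, j) :: star f)); last first.
  by rewrite fij; apply/edge_mon_dup/mem_star.
have p' := p; rewrite perm_sym in p'.
apply: reduces_trans (reduces_cons _ (reduces_perm p)) _.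
apply: reduces_trans _ (reduces_cons _ (reduces_perm p')).
by apply: reduces_triangle => //; rewrite fij eq_sym.
Qed.

Lemma star_merge f p q : min_rep f -> f p = p -> f q = q -> (p < q)%N ->
  exists2 g, min_rep g & reduces ((p, q) :: star f) (star g)
    /\ size (star g) = (size (star f)).+1.
Proof.
move=> mf fp fq ltpq; have [ff fle] := min_repP _ mf.
have npq : p != q by rewrite -val_eqE neq_ltn ltpq.
pose g := [ffun x => if f x == q then p else f x].
have mg : min_rep g.
  apply/min_repP; split=> x; rewrite !ffunE; have [e|ne] := eqVneq (f x) q.
  - by rewrite fp (negbTE npq).
  - by rewrite ff (negbTE ne).
  - by rewrite (leq_trans (ltnW ltpq)) // -e.
  - exact: fle.
have perm_g : perm_eq (q :: nonroots f) (nonroots g).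
  apply: uniq_perm; rewrite /= ?nonroots_uniq ?mem_nonroots ?fq ?eqxx //.
  move=> x; rewrite inE !mem_nonroots ffunE.
  have [->|nxq] := eqVneq x q; first by rewrite fq eqxx npq.
  rewrite /=; case: (eqVneq (f x) q) => // e; rewrite e eq_sym nxq.
  by apply/esym; apply: contraNneq npq => epx; rewrite -fp epx e.
exists g => //; split; last by rewrite !size_map -(perm_size perm_g).
apply: reduces_trans (reduces_perm (perm_map (fun x => (g x, x)) perm_g)).
rewrite /= ffunE fq eqxx.
have: all (fun x => f x != x) (nonroots f) by apply/allP => x;
  rewrite mem_nonroots.
rewrite /star; elim: (nonroots f) => [_|x l IHl /= /andP[nx /IHl{}IHl]].
  exact: reduces_refl.
apply: (@reduces_trans ((p, q) :: (g x, x) :: [seq (f x, x) | x <- l]));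
  last first.
  apply: reduces_trans (reduces_swap _ _ _) _.
  apply: reduces_trans (reduces_cons _ IHl) _.
  exact: reduces_swap.
rewrite ffunE; case: eqVneq => [e|_]; last exact: reduces_refl.
rewrite e in nx *.
apply: reduces_trans (reduces_swap _ _ _) _.
apply: reduces_trans (reduces_swap _ _ _).
apply: reduces_triangle => //.
by apply: contraNneq npq => exp; rewrite -fp -exp e.
Qed.

Lemma star_spanning s : Ipfb (edge_mon s) \/
  exists2 f, min_rep f & reduces s (star f) /\ size (star f) = size s.
Proof.
elim: s => [|[i j] s [is0|[f mf [sf size_f]]]].
- pose f : {ffun 'I_n -> 'I_n} := [ffun x => x].
  have f0 : star f = [::].
    rewrite /star /nonroots (eq_filter (a2 := pred0)) ?filter_pred0 // => x.
    by rewrite ffunE eqxx.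
  right; exists f; first by apply/min_repP; split=> x; rewrite !ffunE.
  by rewrite f0; split=> //; apply: reduces_refl.
- by left; rewrite edge_mon_cons; apply: idealMl.
have [ff _] := min_repP _ mf.
have sf' := reduces_cons (i, j) sf.
have [fij|nfij] := eqVneq (f i) (f j).
  by left; apply: (reduces_ideal sf'); apply: star_cycle.
right.
have red1 : reduces ((i, j) :: s) ((f i, f j) :: star f).
  apply: reduces_trans sf' _; apply: reduces_trans (star_slide mf nfij) _.
  apply: reduces_trans (reduces_flip _ _ _) _.
  apply: reduces_trans (star_slide mf _) _; first by rewrite ff eq_sym.
  exact: reduces_flip.
have [lt_ij|lt_ji|/val_inj e] := ltngtP (f i) (f j);
  last by rewrite e eqxx in nfij.
  have [g mg [fg size_g]] := star_merge mf (ff i) (ff j) lt_ij.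
  exists g; first exact: mg.
  by split; [apply: reduces_trans red1 fg | rewrite /= size_g size_f].
have [g mg [fg size_g]] := star_merge mf (ff j) (ff i) lt_ji.
exists g; first exact: mg.
split; last by rewrite /= size_g size_f.
apply: reduces_trans fg; apply: reduces_trans red1 _; exact: reduces_flip.
Qed.

End Spanning.

(** * Determinants attached to star forests *)

Section Wedge.
Variables (n : nat) (f : {ffun 'I_n -> 'I_n}).
Implicit Types (u v : seq 'rV[rat]_n) (s t : seq ('I_n * 'I_n)).

(* The indicators of the blocks complete a basis of V_pi into a basis of Q^n; *)
(* each root indexes the row of its block, and the nonroots, in increasing    *)
(* order, those of the vectors of u.                                          *)
Definition wedge_mx u : 'M[rat]_n :=
  \matrix_i (if f i == i then \row_j (f j == i)%:R
             else nth 0 u (index i (nonroots f))).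

Definition wedge u := \det (wedge_mx u).

Definition edge_vec (e : 'I_n * 'I_n) : 'rV[rat]_n :=
  delta_mx 0 e.2 - delta_mx 0 e.1.

Definition star_coef s :=
  (all (fun e => f e.1 == f e.2) s)%:R * wedge (map edge_vec s).

Lemma wedge_mxE u i j : wedge_mx u i j =
  if f i == i then (f j == i)%:R else nth 0 u (index i (nonroots f)) 0 j.
Proof. by rewrite mxE; case: ifP; rewrite ?mxE. Qed.

Lemma nonroots_nth a : (a < size (nonroots f))%N ->
  exists2 i, f i != i & index i (nonroots f) = a.
Proof.
case e: (nonroots f) => [|i0 r] //; rewrite -e => lt_a.
exists (nth i0 (nonroots f) a); first by rewrite -mem_nonroots mem_nth.
by rewrite index_uniq // nonroots_uniq.
Qed.

Lemma nth_replace u v (x y : 'rV[rat]_n) a : a != size u ->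
  nth 0 (u ++ x :: v) a = nth 0 (u ++ y :: v) a.
Proof.
rewrite !nth_cat neq_ltn; case: ltnP => //= le_ua lt_ua.
by rewrite -(subnSK lt_ua).
Qed.

Lemma nth_size_cat u v (x : 'rV[rat]_n) : nth 0 (u ++ x :: v) (size u) = x.
Proof. by rewrite nth_cat ltnn subnn. Qed.

Lemma nonroots_index_inj i j : f i != i -> f j != j ->
  index i (nonroots f) = index j (nonroots f) -> i = j.
Proof.
rewrite -!mem_nonroots => hi hj e.
by rewrite -(nth_index i hi) e nth_index.
Qed.

Lemma wedgeD u x y v : (size u < size (nonroots f))%N ->
  wedge (u ++ (x + y) :: v) = wedge (u ++ x :: v) + wedge (u ++ y :: v).
Proof.
move/nonroots_nth => [i fi ii].
have E z : row' i (wedge_mx (u ++ z :: v)) = row' i (wedge_mx (u ++ (x + y) ::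
  v)).
  apply/row_matrixP => k; rewrite !row_rowsub !rowK; case: ifP => // /negbT fk.
  apply: nth_replace; rewrite -ii; apply: contraNneq (neq_lift i k) => e.
  by rewrite eq_sym; apply/eqP/nonroots_index_inj.
rewrite /wedge (determinant_multilinear (B := wedge_mx (u ++ x :: v))
  (C := wedge_mx (u ++ y :: v)) (i0 := i) (b := 1) (c := 1)) ?mul1r //.
by rewrite !scale1r !rowK (negbTE fi) ii !nth_size_cat.
Qed.

Lemma wedge_dup u x v : ((size u).+1 < size (nonroots f))%N ->
  wedge (u ++ x :: x :: v) = 0.
Proof.
move=> h2; have [i fi ii] := nonroots_nth (ltnW h2).
have [j fj jj] := nonroots_nth h2.
rewrite /wedge; apply: (@determinant_alternate _ _ _ i j).
  by apply/eqP => e; move: ii; rewrite e jj => /eqP; rewrite eqn_leq ltnn.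
move=> k; rewrite !mxE (negbTE fi) (negbTE fj) ii jj nth_size_cat.
by rewrite nth_cat ltnNge leqnSn subSnn.
Qed.

Lemma wedge0 u v : (size u < size (nonroots f))%N -> wedge (u ++ 0 :: v) = 0.
Proof.
move/(wedgeD 0 0 v); rewrite addr0 => /eqP.
by rewrite -subr_eq0 opprD addNKr oppr_eq0 => /eqP.
Qed.

Lemma wedge_swap u x y v : ((size u).+1 < size (nonroots f))%N ->
  wedge (u ++ x :: y :: v) + wedge (u ++ y :: x :: v) = 0.
Proof.
move=> h; have := wedge_dup (x + y) v h; rewrite wedgeD ?(ltnW h) //.
have D z : wedge (u ++ z :: (x + y) :: v) = wedge (u ++ z :: x ::
  v) + wedge (u ++ z :: y :: v).
  by rewrite -!(cat_rcons z) wedgeD // size_rcons.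
by rewrite !D !wedge_dup // add0r addr0.
Qed.

Local Notation m := (size (nonroots f)).

Lemma star_coef_asym s t i j : size (s ++ (i, j) :: t) = m ->
  star_coef (s ++ (i, j) :: t) + star_coef (s ++ (j, i) :: t) = 0.
Proof.
move=> sz; rewrite /star_coef !all_cat /= [f j == f i]eq_sym -mulrDr !map_cat
  /=.
rewrite -wedgeD ?size_map; last by rewrite -sz size_cat /= addnS ltnS leq_addr.
by rewrite /edge_vec /= addrC subrKA subrr wedge0 ?mulr0 // size_map -sz
  size_cat /= addnS ltnS leq_addr.
Qed.

Lemma star_coef_diag s t i : size (s ++ (i, i) :: t) = m ->
  star_coef (s ++ (i, i) :: t) = 0.
Proof.
move=> sz; rewrite /star_coef map_cat /= /edge_vec subrr wedge0 ?mulr0 //.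
by rewrite size_map -sz size_cat /= addnS ltnS leq_addr.
Qed.

Let lt_size s t e1 e2 : size (s ++ e1 :: e2 :: t) = m ->
  ((size (map edge_vec s)).+1 < m)%N.
Proof. by move<-; rewrite size_map size_cat /= !addnS !ltnS leq_addr. Qed.

Lemma star_coef_sqr s t e : size (s ++ e :: e :: t) = m ->
  star_coef (s ++ e :: e :: t) = 0.
Proof. by move/lt_size=> sz; rewrite /star_coef map_cat /= wedge_dup ?mulr0.
  Qed.

Lemma star_coef_swap s t e1 e2 : size (s ++ e1 :: e2 :: t) = m ->
  star_coef (s ++ e1 :: e2 :: t) + star_coef (s ++ e2 :: e1 :: t) = 0.
Proof.
move/lt_size=> sz; rewrite /star_coef !all_cat /= [X in _ + (_ && X)%:R *
  _]andbCA.
by rewrite -mulrDr !map_cat /= wedge_swap ?mulr0.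
Qed.

Let edge_vecD i j k : edge_vec (i, k) = edge_vec (i, j) + edge_vec (j, k).
Proof. by rewrite /edge_vec /= [RHS]addrC subrKA. Qed.

Lemma star_coef_tri1 s t i j k : size (s ++ (i, j) :: (i, k) :: t) = m ->
  star_coef (s ++ (i, j) :: (i, k) :: t) = star_coef (s ++ (i, j) :: (j, k) ::
    t).
Proof.
move/lt_size=> sz; rewrite /star_coef !all_cat /= !map_cat /=.
have [fij|_] := eqVneq (f i) (f j); last by rewrite andbF !mul0r.
rewrite -fij (edge_vecD i j k) -!(cat_rcons (edge_vec (i, j))) wedgeD
  ?size_rcons //.
by rewrite cat_rcons wedge_dup // add0r.
Qed.

Lemma star_coef_tri2 s t i j k : size (s ++ (i, k) :: (j, k) :: t) = m ->
  star_coef (s ++ (i, k) :: (j, k) :: t) = star_coef (s ++ (i, j) :: (j, k) ::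
    t).
Proof.
move/lt_size=> sz; rewrite /star_coef !all_cat /= !map_cat /=.
have [fjk|_] := eqVneq (f j) (f k); last by rewrite !(andbF, andFb) !mul0r.
rewrite -fjk (edge_vecD i j k) wedgeD ?(ltnW sz) //.
by rewrite wedge_dup // addr0.
Qed.

End Wedge.

Arguments edge_vec {n}.

Section Coordinates.
Variables n m : nat.
Local Notation G := (gen n).
Implicit Types (f : {ffun 'I_n -> 'I_n}) (s t : seq ('I_n * 'I_n)) (u v :
  seq G).

Definition min_reps := [set f : {ffun 'I_n -> 'I_n} | min_rep f && (size
  (nonroots f) == m)].

Definition rep (j : 'I_#|min_reps|) : {ffun 'I_n -> 'I_n} := enum_val j.

Lemma min_repsP (j : 'I_#|min_reps|) :
  min_rep (rep j) /\ size (nonroots (rep j)) = m.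
Proof. by have := enum_valP j; rewrite inE => /andP[mf /eqP]. Qed.

Definition star_dual : 'M[rat]_(hdim G m, #|min_reps|) :=
  \matrix_(i, j) (star_coef (rep j) (map val (enum_val i : m.-tuple G))
                  / star_coef (rep j) (star (rep j))).

Definition star_mx : 'M[rat]_(#|min_reps|, hdim G m) :=
  \matrix_j coord m (edge_mon (star (rep j))).

Lemma rgen_val (g : G) : rgen (val g).1 (val g).2 = word [:: g].
Proof. by rewrite /rgen -surjective_pairing valK. Qed.

Lemma edge_mon_word u : edge_mon (map val u) = word u.
Proof.
elim: u => [|g u IHu]; first by rewrite /edge_mon big_nil word_nil.
by rewrite /= edge_mon_cons IHu rgen_val -word_cat.
Qed.

Lemma all_gen_or_diag s : (exists u, s = map val u) \/ exists i, (i, i) \in s.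
Proof.
elim: s => [|[i j] s [[u ->]|[k ks]]]; first by left; exists [::].
- have [->|nij] := eqVneq i j; first by right; exists j; rewrite mem_head.
  by left; exists ((Sub (i, j) nij : G) :: u).
- by right; exists k; rewrite inE ks orbT.
Qed.

Lemma coord_word (u : m.-tuple G) : coord m (word u) = delta_mx 0 (enum_rank u).
Proof.
apply/rowP => i; rewrite !mxE mcoeffU1 fmP eqxx /=.
by rewrite -(inj_eq enum_val_inj) enum_rankK -val_eqE eq_sym.
Qed.

Lemma coord_word_size u : size u != m -> coord m (word u) = 0.
Proof.
move=> nu; apply/rowP => i; rewrite !mxE mcoeffU1 fmP /=.
by case: eqP => // e; rewrite e size_tuple eqxx in nu.
Qed.

Lemma edge_mon_diag s i : (i, i) \in s -> edge_mon s = 0.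
Proof.
by case/splitPr=> s1 s2; rewrite edge_mon_cat edge_mon_cons rgen_diag mul0r
  mulr0.
Qed.

Lemma coord_edge_mon_size s : size s != m -> coord m (edge_mon s) = 0.
Proof.
have [[u ->]|[i si]] := all_gen_or_diag s; last by rewrite (edge_mon_diag si)
  linear0.
by rewrite edge_mon_word size_map; apply: coord_word_size.
Qed.

Lemma coord_edge_mon s j : size s = m ->
  (coord m (edge_mon s) *m star_dual) 0 j
    = star_coef (rep j) s / star_coef (rep j) (star (rep j)).
Proof.
have [[u ->]|[i si]] := all_gen_or_diag s => sz.
  rewrite edge_mon_word; rewrite size_map in sz.
  have -> : u = tcast sz (in_tuple u) :> seq G by rewrite val_tcast.
  by rewrite coord_word -rowE !mxE enum_rankK.
rewrite (edge_mon_diag si) linear0 mul0mx mxE.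
case/splitPr: si sz => s1 s2 sz; rewrite star_coef_diag ?mul0r //.
by rewrite sz (min_repsP j).2.
Qed.

Lemma edge_mon_mid1 u v i j :
  word u * rgen i j * word v = edge_mon (map val u ++ (i, j) :: map val v).
Proof. by rewrite edge_mon_cat edge_mon_cons !edge_mon_word mulrA. Qed.

Lemma edge_mon_mid2 u v i j k l :
  word u * (rgen i j * rgen k l) * word v
    = edge_mon (map val u ++ (i, j) :: (k, l) :: map val v).
Proof. by rewrite edge_mon_cat 2!edge_mon_cons 2!edge_mon_word -2!mulrA. Qed.

Definition star_pairing (x : free_alg G) := coord m x *m star_dual.

Lemma star_pairing_midD u v x y c :
  star_pairing (word u * (x + c *: y) * word v)
    = star_pairing (word u * x * word v) + c *:
      star_pairing (word u * y * word v).
Proof.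
rewrite /star_pairing mulrDr mulrDl linearD mulmxDl free_scalerAr.
by rewrite -[_ *: _ * word v]scalerAl linearZ -scalemxAl.
Qed.

Lemma star_pairing_edge_mon s t c : size s = size t ->
    (forall j, size s = size (nonroots (rep j)) ->
      star_coef (rep j) s + c * star_coef (rep j) t = 0) ->
  star_pairing (edge_mon s) + c *: star_pairing (edge_mon t) = 0.
Proof.
move=> st h; rewrite /star_pairing; have [sz|nsz] := eqVneq (size s) m;
  last first.
  by rewrite !coord_edge_mon_size -?st // mul0mx scaler0 addr0.
apply/rowP => j; rewrite mxE [X in _ + X]mxE !coord_edge_mon -?st // mxE.
by rewrite mulrA -mulrDl h ?mul0r // (min_repsP j).2.
Qed.

Lemma star_pairing_add u v rho x y (s t : seq ('I_n * 'I_n)) c :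
    rho = x + c *: y ->
    word u * x * word v = edge_mon s -> word u * y * word v = edge_mon t ->
    size s = size t ->
    (forall j, size s = size (nonroots (rep j)) ->
      star_coef (rep j) s + c * star_coef (rep j) t = 0) ->
  star_pairing (word u * rho * word v) = 0.
Proof.
move=> -> xs yt st h; apply: etrans (star_pairing_midD u v x y c) _.
apply: etrans (star_pairing_edge_mon st h).
exact: (congr2 (fun a b => star_pairing a + c *: star_pairing b) xs yt).
Qed.

Lemma relators_star_dual u v rho : rho \in pfb_relators n ->
  coord m (word u * rho * word v) *m star_dual = 0.
Proof.
rewrite -/(star_pairing _) !mem_cat; case/orP=> [|/or4P[]].
- case/allpairsP=> -[i j] [_ _ /= e]; rewrite -[rgen j i]scale1r in e.
  apply: (star_pairing_add e (edge_mon_mid1 u v i j) (edge_mon_mid1 u v j i)).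
    by rewrite !size_cat.
  by move=> k /star_coef_asym; rewrite mul1r.
- case/mapP=> x _; rewrite -rgen_val => e.
  have {}e : rho = rgen (val x).1 (val x).2 * rgen (val x).1 (val x).2
                   + 0 *: (rgen (val x).1 (val x).2 * rgen (val x).1 (val x).2).
    by rewrite scale0r addr0.
  apply: (star_pairing_add e (edge_mon_mid2 u v _ _ _ _) (edge_mon_mid2 u v _ _
    _ _)).
    by [].
  by move=> k /star_coef_sqr->; rewrite mul0r addr0.
- case/allpairsP=> -[x1 x2] [_ _]; rewrite -[(x1, x2).1]/x1 -[(x1, x2).2]/x2.
  rewrite -!rgen_val -[X in _ + X]scale1r => e.
  apply: (star_pairing_add e (edge_mon_mid2 u v _ _ _ _) (edge_mon_mid2 u v _ _
    _ _)).
    by rewrite !size_cat.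
  by move=> k /star_coef_swap; rewrite mul1r.
- case/mapP=> -[[i j] k] _; rewrite -scaleN1r => e.
  apply: (star_pairing_add e (edge_mon_mid2 u v _ _ _ _) (edge_mon_mid2 u v _ _
    _ _)).
    by rewrite !size_cat.
  by move=> l /star_coef_tri1->; rewrite mulN1r subrr.
case/mapP=> -[[i j] k] _; rewrite -scaleN1r => e.
apply: (star_pairing_add e (edge_mon_mid2 u v _ _ _ _) (edge_mon_mid2 u v _ _ _
  _)).
  by rewrite !size_cat.
by move=> l /(star_coef_tri2 (j := j))->; rewrite mulN1r subrr.
Qed.

Lemma ideal_star_dual : (ideal_mx (pfb_relators n) m <= kermx star_dual)%MS.
Proof.
rewrite /ideal_mx; apply/sumsmx_subP => a _; apply/sumsmx_subP => b _.
apply/sumsmx_subP => u _; apply/sumsmx_subP => v _; rewrite big_seq.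
apply: (big_ind (fun M : 'M_(hdim G m) => (M <= kermx star_dual)%MS)).
- exact: sub0mx.
- by move=> M1 M2 h1 h2; rewrite addsmx_sub h1.
- move=> rho h; rewrite genmxE; apply/sub_kermxP; exact: relators_star_dual.
Qed.

Lemma coord_star_span (u : m.-tuple G) :
  (coord m (word u) <= ideal_mx (pfb_relators n) m + star_mx)%MS.
Proof.
rewrite -edge_mon_word.
have [i0|[f mf [[c red] sz]]] := star_spanning (map val u).
  by apply: submx_trans (addsmxSl _ _); apply: ideal_sub_mx.
rewrite -[edge_mon _](subrK (c *: edge_mon (star f))) linearD addmx_sub //.
  by apply: submx_trans (addsmxSl _ _); apply: ideal_sub_mx.
rewrite linearZ /= scalemx_sub // (submx_trans _ (addsmxSr _ _)) //.
have fD : f \in min_reps by move: sz; rewrite inE mf !size_map size_tuple =>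
  ->; rewrite eqxx.
have -> : coord m (edge_mon (star f)) = row (enum_rank_in fD f) star_mx.
  by rewrite rowK /rep enum_rankK_in.
exact: row_sub.
Qed.

End Coordinates.

(** * The trace on the quotient *)

Section Trace.
Variable n : nat.
Implicit Types (f : {ffun 'I_n -> 'I_n}) (s : 'S_n) (l : seq ('I_n * 'I_n)).

Definition edge_perm s (e : 'I_n * 'I_n) := (s e.1, s e.2).

Lemma nth_star (V : nmodType) f (h : 'I_n * 'I_n -> V) i : f i != i ->
  nth 0 (map h (star f)) (index i (nonroots f)) = h (f i, i).
Proof.
rewrite -mem_nonroots => fi; rewrite -map_comp (nth_map i) ?index_mem //.
by rewrite /= nth_index.
Qed.

Lemma wedge_star_neq0 f : min_rep f -> wedge f (map edge_vec (star f)) != 0.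
Proof.
case/min_repP=> ff _; rewrite /wedge -det_tr; apply/det0P => -[v nv0 vM].
have Mv i : \sum_j v 0 j * wedge_mx f (map edge_vec (star f)) i j = 0.
  by move/rowP/(_ i): vM; rewrite !mxE  => e; rewrite -[RHS]e; apply:
    eq_bigr => j _; rewrite [_^T _ _]mxE.
have vf i : v 0 (f i) = v 0 i.
  have [->//|fi] := eqVneq (f i) i.
  have := Mv i; rewrite (eq_bigr (fun j => v 0 j * (j == i)%:R - v 0 j * (j ==
    f i)%:R)) => [|j _]; last first.
    by rewrite wedge_mxE (negbTE fi) nth_star // !mxE !eqxx /= mulrBr.
  have D k : \sum_j v 0 j * (j == k)%:R = v 0 k.
    rewrite (bigD1 k) //= eqxx mulr1 big1 ?addr0 // => j /negbTE->.
    by rewrite mulr0.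
  by rewrite sumrB !D => /eqP; rewrite subr_eq0 => /eqP.
case/negP: nv0; apply/eqP/rowP => i; rewrite mxE.
have := Mv (f i); under eq_bigr => j _ do rewrite wedge_mxE ff eqxx -vf
  mulr_natr mulrb.
rewrite -big_mkcond /= (eq_bigr (fun=> v 0 i)) => [|j /eqP->];
  last by rewrite vf.
rewrite sumr_const => /eqP; rewrite mulrn_eq0 => /orP[|/eqP//].
by move/eqP/card0_eq/(_ i)/negbT/negP; case; apply: eqxx.
Qed.

Lemma star_coef_perm f s : 
  star_coef f (map (edge_perm s) (star f)) =
  [forall x, f (s x) == f (s (f x))]%:R * wedge f (map edge_vec (map (edge_perm
    s) (star f))).
Proof.
rewrite /star_coef; congr (_%:R * _); congr nat_of_bool.
rewrite -map_comp all_map; apply/allP/forallP => [h x|h x _] /=;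
  last by rewrite eq_sym.
have [->//|fx] := eqVneq (f x) x.
by rewrite eq_sym; have := h x; rewrite mem_nonroots; apply.
Qed.

Lemma star_coef_star f : (forall x, f (f x) = f x) ->
  star_coef f (star f) = wedge f (map edge_vec (star f)).
Proof.
move=> ff; rewrite /star_coef all_map (introT allP) ?mul1r // => x _ /=.
by rewrite ff.
Qed.

Lemma perm_root_inj f s : (forall x, f (f x) = f x) ->
    (forall x, f (s x) = f (s (f x))) ->
  forall p q, f p = p -> f q = q -> f (s p) = f (s q) -> p = q.
Proof.
move=> ff fs p q; pose T := [set x | f x == x].
have hT : [set f (s x) | x in T] = T.
  apply/setP => y; rewrite inE; apply/imsetP/eqP => [[x _ ->]|fy]; first exact:
    ff.
  by exists (f ((s^-1)%g y)); rewrite ?inE ?ff // -fs permKV fy.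
have /imset_injP h_inj : #|[set f (s x) | x in T]| == #|T| by rewrite hT.
by move=> fp fq; apply: h_inj; rewrite inE ?fp ?fq.
Qed.

Lemma star_coef_star_perm f s : min_rep f ->
    (forall x, f (s x) = f (s (f x))) ->
  exists2 R : 'S_n, forall x, R x = (if f x == x then f (s x) else x) &
    star_coef f (map (edge_perm s) (star f)) / star_coef f (star f)
      = (-1) ^+ R * (-1) ^+ s.
Proof.
move=> mf fs; have [ff _] := min_repP _ mf.
have fs_inj := perm_root_inj ff fs.
pose r (x : 'I_n) := if f x == x then f (s x) else x.
have r_inj : injective r.
  move=> x y; rewrite /r; case: eqP => fx; case: eqP => fy //.
  - exact: fs_inj.
  - by move=> e; case: fy; rewrite -e ff.
  - by move=> e; case: fx; rewrite e ff.
exists (perm r_inj) => [x|]; first by rewrite permE.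
have fsE i j : f i = i -> (f (s j) == f (s i)) = (f j == i).
  move=> fi; apply/eqP/eqP => [|<-]; last exact: fs.
  by rewrite fs => /(fs_inj _ _ (ff j) fi).
rewrite star_coef_perm star_coef_star //.
have -> : [forall x, f (s x) == f (s (f x))] by apply/forallP => x; rewrite -fs.
rewrite mul1r; set N := wedge_mx f (map edge_vec (map (edge_perm s) (star f))).
pose M := wedge_mx f (map edge_vec (star f)).
have E : row_perm (perm r_inj) N = col_perm s^-1 M.
  apply/matrixP => i j; rewrite !mxE permE /r -{1}[j](permKV s).
  have [fi|fi] := eqVneq (f i) i.
    by rewrite ff eqxx !mxE fsE.
  rewrite (negbTE fi) -map_comp !nth_star // !mxE /=.
  by rewrite !(inj_eq perm_inj).
have nM : \det M != 0 := wedge_star_neq0 mf.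
have /(congr1 determinant) := E; rewrite row_permE col_permE !det_mulmx
  !det_perm invgK => E'.
rewrite -/(\det N) /wedge -/M -/N; apply: (canLR (mulfK nM)).
by rewrite -mulrA [X in _ * X]mulrC -E' mulrA -expr2 sqrr_sign mul1r.
Qed.

Lemma free_map_edge_mon s l :
  free_map (gen_act s) (edge_mon l) = edge_mon (map (edge_perm s) l).
Proof.
elim: l => [|e l IHl]; first by rewrite /edge_mon !big_nil -word_nil
  free_map_word.
by rewrite /= !edge_mon_cons free_mapM free_map_r IHl.
Qed.

Lemma mxtrace_retract N r d (P : 'M[rat]_(r, N)) (Q : 'M_(N, r))
    (A : 'M_(N, d)) (B : 'M_(d, N)) (g : 'M_N) :
    P *m Q = 1%:M -> A *m B *m Q = Q -> Q *m P *m A = A ->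
    Q *m P *m (g *m A) = g *m A ->
  \tr (P *m g *m Q) = \tr (B *m g *m A).
Proof.
move=> PQ ABQ QPA QPgA.
have -> : P *m g *m Q = P *m A *m (B *m Q *m P *m g *m Q).
  by rewrite -{1}[P *m g *m Q]mul1mx -PQ -{1}ABQ !mulmxA.
rewrite mxtrace_mulC.
have -> : B *m Q *m P *m g *m Q *m (P *m A) = B *m (Q *m P *m (g *m (Q *m P *m
  A))).
  by rewrite !mulmxA.
by rewrite QPA QPgA mulmxA.
Qed.

Lemma mxtrace_factmod (gT : finGroupType) (H : {group gT}) N d
    (rH : mx_representation rat H N) (U : 'M_N) (modU : mxmodule rH U)
    (A : 'M_(N, d)) (B : 'M_(d, N)) x : x \in H ->
    (U <= kermx A)%MS -> (1%:M - A *m B <= U)%MS ->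
  \tr (factmod_repr modU x) = \tr (B *m rH x *m A).
Proof.
move=> Hx /sub_kermxP UA sAB.
pose P := val_factmod (1%:M : 'M_(\rank (cokermx U)));
  pose Q := in_factmod U (1%:M : 'M_N).
have Q0 k (W : 'M_(k, N)) : (W <= U)%MS -> W *m Q = 0.
  by rewrite -in_factmod_eq0 in_factmodE => /eqP.
have A0 k (W : 'M_(k, N)) : (W <= U)%MS -> W *m A = 0.
  by case/submxP=> D ->; rewrite -mulmxA UA mulmx0.
have PQ : P *m Q = 1%:M by rewrite -in_factmodE val_factmodK.
have sQP : (1%:M - Q *m P <= U)%MS.
  rewrite -in_factmod_eq0 in_factmodE -/Q mulmxBl mul1mx -mulmxA PQ mulmx1.
  by rewrite subrr.
have QPA : Q *m P *m A = A.
  by apply/esym/eqP; rewrite -subr_eq0 -{1}[A]mul1mx -mulmxBl A0.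
have ABQ : A *m B *m Q = Q.
  by apply/esym/eqP; rewrite -subr_eq0 -{1}[Q]mul1mx -mulmxBl Q0.
have QPgA : Q *m P *m (rH x *m A) = rH x *m A.
  apply/esym/eqP; rewrite -subr_eq0 -{1}[rH x *m A]mul1mx -mulmxBl mulmxA A0 //.
  apply: submx_trans (mxmoduleP modU x Hx); exact: submxMr.
have -> : factmod_repr modU x = P *m rH x *m Q.
  by rewrite /= /factmod_mx in_factmodE.
exact: mxtrace_retract.
Qed.

Lemma card_roots f : (#|[set x | f x == x]| + size (nonroots f))%N = n.
Proof.
rewrite -[RHS]card_ord -(cardC [set x | f x == x]) -(card_uniqP (nonroots_uniq
  f)).
by congr (_ + _)%N; apply: eq_card => x; rewrite mem_nonroots !inE.
Qed.

Lemma min_rep_eq f g : min_rep f -> min_rep g ->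
  size (nonroots f) = size (nonroots g) -> (forall x, g (f x) = g x) -> f = g.
Proof.
move=> /min_repP[ff fle] /min_repP[gg gle] sz gf.
pose T := [set x | f x == x].
have gT : g @: T = [set x | g x == x].
  apply/setP => y; rewrite inE; apply/imsetP/eqP => [[x _ ->]|gy]; first exact:
    gg.
  by exists (f y); rewrite ?inE ?ff ?gf ?gy.
have /imset_injP g_inj : #|g @: T| == #|T| by rewrite gT -(eqn_add2r (size
  (nonroots f))) {1}sz !card_roots.
have fg x : f (g x) = f x by apply: g_inj; rewrite ?inE ?ff // !gf gg.
apply/ffunP => x; apply/val_inj/eqP; rewrite eqn_leq.
by rewrite -{1}fg fle -gf gle.
Qed.

Lemma star_mxK m : star_mx n m *m star_dual n m = 1%:M.
Proof.
apply/row_matrixP => i; rewrite row_mul rowK row1; apply/rowP => j.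
have [mi si] := min_repsP i; have [mj sj] := min_repsP j.
have [[ffi _] [ffj _]] := (min_repP _ mi, min_repP _ mj).
rewrite coord_edge_mon ?size_map // mxE eqxx /=.
have [<-|nij] := eqVneq i j; first by rewrite divff // star_coef_star //
  wedge_star_neq0.
rewrite [X in X / _](_ : _ = 0) ?mul0r //.
apply/eqP; rewrite mulf_eq0 pnatr_eq0 eqb0; apply/orP; left.
apply: contra nij; rewrite all_map => /allP h; apply/eqP/enum_val_inj.
apply: min_rep_eq; rewrite // ?si ?sj // => x.
have [->//|nx] := eqVneq (rep i x) x.
by apply/eqP; have := h x; rewrite mem_nonroots; apply.
Qed.

Lemma star_dualK m : (1%:M - star_dual n m *m star_mx n m <= ideal_mx
  (pfb_relators n) m)%MS.
Proof.
apply/row_subP => i; rewrite linearB /= row1 row_mul.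
have := coord_star_span (enum_val i : m.-tuple (gen n));
  rewrite coord_word enum_valK.
case/sub_addsmxP => -[/= c d] e.
have cI : (c *m ideal_mx (pfb_relators n) m <= ideal_mx (pfb_relators n) m)%MS
  := submxMl _ _.
suff -> : delta_mx 0 i - row i (star_dual n m) *m star_mx n m = c *m ideal_mx
  (pfb_relators n) m by [].
have -> : row i (star_dual n m) = d.
  rewrite rowE e mulmxDl -[d *m _ *m _]mulmxA star_mxK mulmx1.
  by rewrite (sub_kermxP (submx_trans cI (ideal_star_dual n m))) add0r.
by rewrite e addrK.
Qed.

Lemma pfb_dual_charE s m : pfb_dual_char s m =
  \sum_(f in min_reps n m) star_coef f (map (edge_perm s) (star f)) / star_coef
    f (star f).
Proof.
rewrite /pfb_dual_char (mxtrace_factmod _ _ (ideal_star_dual n m) (star_dualK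
  m)) ?inE //.
rewrite [RHS]big_enum_val; apply: eq_bigr => j _.
rewrite -/(rep j).
have -> : forall M : 'M[rat]_#|min_reps n m|, M j j = row j M 0 j by move=> M;
  rewrite mxE.
rewrite 2!row_mul rowK -coord_free_map free_map_edge_mon coord_edge_mon //.
by rewrite !size_map (min_repsP j).2.
Qed.
End Trace.

(** * Stable partitions and partitions of the set of cycles *)

Section InvariantPartitions.
Variables (T : finType) (s : {perm T}).
Implicit Types (D : {set T}) (P Q : {set {set T}}) (b : {set T}) (B :
  {set {set T}}) (S : {set {set {set T}}}).

Definition set_perm : {perm {set T}} := perm (imset_inj (@perm_inj _ s)).

Lemma set_permX i b : (set_perm ^+ i)%g b = (s ^+ i)%g @: b.
Proof.
elim: i b => [|i IHi] b.
  by rewrite !expg0 perm1 (eq_imset (g := id)) ?imset_id // => x; rewrite perm1.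
rewrite !expgSr permM IHi permE -imset_comp; apply: eq_imset => x.
by rewrite /= permM.
Qed.

Definition transitive_partition B P :=
  partition P (cover B) && [exists b in P, P == porbit set_perm b].

Definition invariant_partition P :=
  partition P [set: T] && [forall b in P, set_perm b \in P].

(* The partition S of the set of cycles to whose summand P contributes.       *)
Definition merged_cycles P :=
  [set [set c in porbits s | c \subset cover O] | O in porbit set_perm @: P].

Lemma mem_porbits x : porbit s x \in porbits s.
Proof. exact: imset_f. Qed.

Lemma porbit_porbits c x : c \in porbits s -> x \in c -> porbit s x = c.
Proof. by case/imsetP=> y _ -> xy; apply/eqP; rewrite eq_porbit_mem. Qed.

Lemma mem_cover_porbits B x : B \subset porbits s ->
  (x \in cover B) = (porbit s x \in B).
Proof.
move/subsetP=> sB; apply/bigcupP/idP => [[c cB xc]|h];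
  last by exists (porbit s x); rewrite ?porbit_id.
by rewrite (porbit_porbits (sB _ cB) xc).
Qed.

Lemma cover_porbitsK B : B \subset porbits s ->
  [set c in porbits s | c \subset cover B] = B.
Proof.
move=> sB; apply/setP => c; rewrite inE; apply/andP/idP => [[]|cB].
  case/imsetP=> x _ -> /subsetP/(_ x (porbit_id _ _)).
  by rewrite mem_cover_porbits.
by split; [apply: (subsetP sB) | apply: (bigcup_sup c)].
Qed.

Lemma porbit_sub D x : (forall y, y \in D -> s y \in D) -> x \in D ->
  porbit s x \subset D.
Proof.
move=> sD xD; apply/subsetP => _ /porbitP[i ->].
by elim: i => [|i IHi]; rewrite ?expg0 ?perm1 // expgSr permM sD.
Qed.

Lemma cover_stable D : (forall y, y \in D -> s y \in D) ->
  cover [set c in porbits s | c \subset D] = D.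
Proof.
move=> sD; apply/setP => x; apply/bigcupP/idP => [[c]|xD].
  by rewrite inE => /andP[_ /subsetP]; apply.
exists (porbit s x); last exact: porbit_id.
by rewrite inE mem_porbits porbit_sub.
Qed.

Lemma cover_porbit_stable b y :
  y \in cover (porbit set_perm b) -> s y \in cover (porbit set_perm b).
Proof.
case/bigcupP=> c bc yc; apply/bigcupP; exists (set_perm c);
  last by rewrite permE imset_f.
by rewrite -[set_perm c]/((set_perm ^+ 1)%g c) -eq_porbit_mem porbit_perm
  eq_porbit_mem.
Qed.

Section Invariant.
Variable P : {set {set T}}.
Hypothesis invP : invariant_partition P.

Let partP : partition P [set: T]. Proof. by case/andP: invP. Qed.

Lemma invariant_mem b b' x : b \in P -> b' \in P -> x \in b -> x \in b' -> b =
  b'.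
Proof.
move=> bP b'P xb xb'; have tP := partition_trivIset partP.
by rewrite -(def_pblock tP bP xb) (def_pblock tP b'P xb').
Qed.

Lemma invariant_block x : exists2 b, b \in P & x \in b.
Proof.
have : x \in cover P by rewrite (cover_partition partP) inE.
by case/bigcupP=> b; exists b.
Qed.

Lemma invariant_neq0 b : b \in P -> exists x, x \in b.
Proof. by move/(partition_neq0 partP)/set0Pn. Qed.

Lemma invariant_porbit b b' : b \in P -> b' \in porbit set_perm b -> b' \in P.
Proof.
move=> bP /porbitP[i ->]; elim: i => [|i IHi]; first by rewrite expg0 perm1.
by rewrite expgSr permM; case/andP: invP => _ /forall_inP; apply.
Qed.

Lemma invariant_porbit_mem b b' x : b \in P -> b' \in P -> x \in b' ->
  (x \in cover (porbit set_perm b)) = (b' \in porbit set_perm b).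
Proof.
move=> bP b'P xb'; apply/bigcupP/idP => [[c bc xc]|]; last by exists b'.
by rewrite (invariant_mem b'P (invariant_porbit bP bc) xb' xc).
Qed.

Lemma cover_merged b :
  cover [set c in porbits s | c \subset cover (porbit set_perm b)]
    = cover (porbit set_perm b).
Proof. exact/cover_stable/cover_porbit_stable. Qed.

Lemma merged_orbit b : b \in P ->
  P ::&: cover (porbit set_perm b) = porbit set_perm b.
Proof.
move=> bP; apply/setP => b'; rewrite inE; apply/andP/idP =>
  [[b'P /subsetP sb']|h].
  have [x xb'] := invariant_neq0 b'P.
  by rewrite -(invariant_porbit_mem bP b'P xb') sb'.
by split; [apply: invariant_porbit h | apply: (bigcup_sup b')].
Qed.

Lemma merged_cycles_partition : partition (merged_cycles P) (porbits s).
Proof.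
apply/and3P; split.
- apply/eqP/setP => c; apply/bigcupP/idP => [[_ /imsetP[O _ ->]]|];
  first by rewrite inE => /andP[].
  case/imsetP=> x _ ->; have [b bP xb] := invariant_block x.
  exists [set c in porbits s | c \subset cover (porbit set_perm b)].
    by apply: imset_f; apply: imset_f.
  rewrite inE mem_porbits porbit_sub //; first exact: cover_porbit_stable.
  by rewrite (invariant_porbit_mem bP bP xb) porbit_id.
- apply/trivIsetP => _ _ /imsetP[_ /imsetP[b bP ->] ->] /imsetP[_ /imsetP[b'
  b'P ->] ->].
  apply: contraR => /pred0Pn[c /andP[]]; rewrite !inE =>
    /andP[/imsetP[x _ ->] /subsetP/(_ x (porbit_id _ _)) h].
  move=> /andP[_ /subsetP/(_ x (porbit_id _ _)) h'].
  have [d dP xd] := invariant_block x.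
  rewrite (invariant_porbit_mem bP dP xd) -eq_porbit_mem in h.
  rewrite (invariant_porbit_mem b'P dP xd) -eq_porbit_mem in h'.
  by rewrite -(eqP h) (eqP h').
apply/negP => /imsetP[_ /imsetP[b bP ->]] /setP e.
have [x xb] := invariant_neq0 bP; have := e (porbit s x).
rewrite !inE mem_porbits porbit_sub //; first exact: cover_porbit_stable.
by rewrite (invariant_porbit_mem bP bP xb) porbit_id.
Qed.

Lemma merged_transitive B : B \in merged_cycles P ->
  transitive_partition B (P ::&: cover B).
Proof.
case/imsetP=> _ /imsetP[b bP ->] ->; rewrite cover_merged merged_orbit //.
rewrite /transitive_partition cover_merged; apply/andP; split; last first.
  by apply/exists_inP; exists b; rewrite ?porbit_id.
apply/and3P; split=> //.
  by apply: trivIsetS (partition_trivIset partP); apply/subsetP => c; apply: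
    invariant_porbit.
apply/negP => /(invariant_porbit bP) h; have [x] := invariant_neq0 h.
by rewrite inE.
Qed.

Lemma merged_bigcup : \bigcup_(B in merged_cycles P) (P ::&: cover B) = P.
Proof.
apply/setP => b; apply/bigcupP/idP => [[B _]|bP]; first by rewrite inE =>
  /andP[].
exists [set c in porbits s | c \subset cover (porbit set_perm b)].
  by apply: imset_f; apply: imset_f.
by rewrite cover_merged merged_orbit // porbit_id.
Qed.

End Invariant.

Section Glue.
Variables (S : {set {set {set T}}}) (phi : {set {set T}} -> {set {set T}}).
Hypothesis partS : partition S (porbits s).
Hypothesis phiP : forall B, B \in S -> transitive_partition B (phi B).

Let subS B : B \in S -> B \subset porbits s.
Proof. exact: partitionS partS. Qed.

Let coverE B : B \in S -> cover (phi B) = cover B.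
Proof. by move/phiP=> /andP[/cover_partition]. Qed.

Let phi_sub B b : B \in S -> b \in phi B -> b \subset cover B.
Proof. by move=> BS bB; rewrite -coverE //; apply: (bigcup_sup b). Qed.

Let phi_neq0 B b : B \in S -> b \in phi B -> exists x, x \in b.
Proof. by move/phiP=> /andP[h _] /(partition_neq0 h)/set0Pn. Qed.

Let S_inj B B' x : B \in S -> B' \in S -> x \in cover B -> x \in cover B' -> B
  = B'.
Proof.
move=> BS B'S; rewrite !mem_cover_porbits ?subS // => xB xB'.
have tS := partition_trivIset partS.
by rewrite -(def_pblock tS BS xB) (def_pblock tS B'S xB').
Qed.

Let phi_orbit B b : B \in S -> b \in phi B -> phi B = porbit set_perm b.
Proof.
move/phiP=> /andP[_ /exists_inP[c _ /eqP ->]] bc.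
by apply/esym/eqP; rewrite eq_porbit_mem.
Qed.

Let phi_nonempty B : B \in S -> exists b, b \in phi B.
Proof. by move/phiP=> /andP[_ /exists_inP[c cB _]]; exists c. Qed.

Let P := \bigcup_(B in S) phi B.

Lemma glue_block B : B \in S -> P ::&: cover B = phi B.
Proof.
move=> BS; apply/setP => b; rewrite inE; apply/andP/idP => [[]|bB].
  case/bigcupP=> B' B'S bB' /subsetP sb; have [x xb] := phi_neq0 B'S bB'.
  rewrite (S_inj BS B'S (sb x xb)) //; exact: (subsetP (phi_sub B'S bB')).
by split; [apply/bigcupP; exists B | apply: phi_sub].
Qed.

Lemma glue_invariant : invariant_partition P.
Proof.
apply/andP; split; last first.
  apply/forall_inP => b /bigcupP[B BS bB]; apply/bigcupP; exists B => //.
  rewrite (phi_orbit BS bB) -[set_perm b]/((set_perm ^+ 1)%g b).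
  exact: mem_porbit.
apply/and3P; split.
- apply/eqP/setP => x; rewrite inE; apply/bigcupP.
  have : porbit s x \in cover S by rewrite (cover_partition partS) mem_porbits.
  case/bigcupP=> B BS; rewrite -mem_cover_porbits ?subS // -coverE //.
  by case/bigcupP=> b bB xb; exists b => //; apply/bigcupP; exists B.
- apply/trivIsetP => b b' /bigcupP[B BS bB] /bigcupP[B' B'S b'B'].
  apply: contraR => /pred0Pn[x /andP[/= xb xb']].
  have e : B = B'.
    by apply: (S_inj BS B'S (x := x)); [apply:
      (subsetP (phi_sub BS bB)) | apply: (subsetP (phi_sub B'S b'B'))].
  rewrite -e in b'B'; have /andP[/partition_trivIset tB _] := phiP BS.
  by rewrite -(def_pblock tB bB xb) (def_pblock tB b'B' xb').
by apply/negP => /bigcupP[B BS /(phi_neq0 BS)[x]]; rewrite inE.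
Qed.

Lemma glue_merged : merged_cycles P = S.
Proof.
have merge B b : B \in S -> b \in phi B ->
    [set c in porbits s | c \subset cover (porbit set_perm b)] = B.
  by move=> BS bB; rewrite -(phi_orbit BS bB) coverE // cover_porbitsK ?subS.
apply/setP => B; apply/imsetP/idP => [[_ /imsetP[b /bigcupP[B' B'S bB'] ->]
  ->]|BS].
  by rewrite (merge _ _ B'S bB').
have [b bB] := phi_nonempty BS; exists (porbit set_perm b);
  last by rewrite (merge B).
by apply: imset_f; apply/bigcupP; exists B.
Qed.

End Glue.

Lemma sum_invariant_partitions (R : comNzRingType)
    (F : {set {set T}} -> {set {set T}} -> R) :
  \sum_(P | invariant_partition P) \prod_(B in merged_cycles P) F B (P ::&:
    cover B)
  = \sum_(S : {set {set {set T}}} | partition S (porbits s))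
      \prod_(B in S) \sum_(P | transitive_partition B P) F B P.
Proof.
rewrite (partition_big merged_cycles (fun S => partition S (porbits s)));
  last exact: merged_cycles_partition.
apply: eq_bigr => S partS; rewrite (big_distr_big_dep set0).
pose restrict P : {ffun {set {set T}} -> {set {set T}}} := [ffun B =>
  if B \in S then P ::&: cover B else set0].
rewrite (reindex_onto (fun phi : {ffun {set {set T}} -> {set {set T}}} =>
  \bigcup_(B in S) phi B) restrict); last first.
  move=> P /andP[invP /eqP eS]; rewrite -[RHS](merged_bigcup invP) eS.
  by apply: eq_bigr => B BS; rewrite ffunE BS.
apply: eq_big => [phi|phi /andP[/andP[_ /eqP eS] /eqP e]]; last first.
  rewrite eS; apply: eq_bigr => B BS.
  by rewrite -[in RHS]e ffunE BS.
apply/andP/pfamilyP => [[/andP[invP /eqP eS] /eqP e]|[sS h]].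
  split=> [|B BS]; last by rewrite -e ffunE BS; apply: merged_transitive;
    rewrite ?eS.
  apply/supportP => B nB; by rewrite -e ffunE (negbTE nB).
have phiP B : B \in S -> transitive_partition B (phi B) := h B.
split; first by rewrite glue_invariant // glue_merged ?eqxx.
apply/eqP/ffunP => B; rewrite ffunE; case: ifPn => [BS|nBS];
  first by rewrite glue_block.
by rewrite (supportP sS).
Qed.

End InvariantPartitions.

Lemma permX_eq (T : finType) (p : {perm T}) x i j :
  ((p ^+ i)%g x == (p ^+ j)%g x) = (i == j %[mod #|porbit p x|]).
Proof.
set k := #|porbit p x|; have k_gt0 : (0 < k)%N by rewrite lt0n card_porbit_neq0.
have pk1 : (p ^+ k)%g x = x by rewrite permX iter_porbit.
have pk a : (p ^+ (a * k))%g x = x.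
  by elim: a => [|a IHa]; rewrite ?expg0 ?perm1 // mulSn expgD permM pk1.
have pmod a : (p ^+ a)%g x = nth x (traject p x k) (a %% k).
  by rewrite nth_traject ?ltn_mod // {1}(divn_eq a k) expgD permM pk permX.
by rewrite !pmod nth_uniq ?size_traject ?ltn_mod // uniq_traject_porbit.
Qed.

Section Counting.
Variables (T : finType) (s : {perm T}) (B : {set {set T}}).
Hypothesis subB : B \subset porbits s.
Implicit Types (P : {set {set T}}) (c : {set T}) (f : T -> nat).

Let coverP x : (x \in cover B) = (porbit s x \in B).
Proof. exact: mem_cover_porbits. Qed.

Let cover_permX x i : ((s ^+ i)%g x \in cover B) = (x \in cover B).
Proof. by rewrite !coverP porbit_perm. Qed.

Lemma transitive_porbit P b : transitive_partition s B P -> b \in P ->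
  P = porbit (set_perm s) b.
Proof.
case/andP=> _ /exists_inP[c _ /eqP ->] bc.
by apply/esym/eqP; rewrite eq_porbit_mem.
Qed.

Lemma transitive_dvd P c : transitive_partition s B P -> c \in B ->
  (#|P| %| #|c|)%N.
Proof.
move=> trP cB; have /imsetP[x _ cx] := subsetP subB _ cB.
have /andP[partP _] := trP.
have : x \in cover P by rewrite (cover_partition partP) coverP -cx.
case/bigcupP=> b bP xb; have Pb := transitive_porbit trP bP.
have xc : (s ^+ #|c|)%g x = x by rewrite cx permX iter_porbit.
have eb : (set_perm s ^+ #|c|)%g b = b.
  have b'P : (set_perm s ^+ #|c|)%g b \in P by rewrite Pb mem_porbit.
  have tP := partition_trivIset partP.
  rewrite -(def_pblock tP b'P (x := x)) ?(def_pblock tP bP xb) //.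
  by rewrite set_permX -[x in x \in _]xc imset_f.
by rewrite Pb /dvdn -(mod0n #|porbit (set_perm s) b|) -permX_eq eb expg0 perm1.
Qed.

Section Colouring.
Variable k : nat.
Hypothesis k_gt0 : (0 < k)%N.

Definition colour_class f i := [set x in cover B | f x == i %[mod k]].

Definition colour_partition f := [set colour_class f (i : 'I_k) | i in 'I_k].

Definition cyclic_colouring f :=
  forall x, x \in cover B -> f (s x) = (f x).+1 %[mod k].

Lemma colour_class_mod f i : colour_class f (i %% k) = colour_class f i.
Proof. by apply/setP => x; rewrite !inE modn_mod. Qed.

Lemma mem_colour_partition f i : colour_class f i \in colour_partition f.
Proof.
rewrite -colour_class_mod.
by apply/imsetP; exists (Ordinal (ltn_pmod i k_gt0)).
Qed.

Lemma cyclic_colouringX f i x : cyclic_colouring f -> x \in cover B ->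
  f ((s ^+ i)%g x) = f x + i %[mod k].
Proof.
move=> cf xB; elim: i => [|i IHi]; first by rewrite expg0 perm1 addn0.
by rewrite expgSr permM cf ?cover_permX // -addn1 -modnDml IHi modnDml addn1
  addnS.
Qed.

Lemma set_perm_colour_class f i t : cyclic_colouring f ->
  (set_perm s ^+ t)%g (colour_class f i) = colour_class f (i + t).
Proof.
move=> cf; rewrite set_permX; apply/setP => y; apply/imsetP/idP.
  case=> x; rewrite inE => /andP[xB /eqP fx] ->.
  by rewrite inE cover_permX xB cyclic_colouringX // -modnDml fx modnDml /=.
rewrite inE => /andP[yB fy]; exists ((s ^- t)%g y); last by rewrite permKV.
have yB' : (s ^- t)%g y \in cover B by rewrite -(cover_permX _ t) permKV.
by rewrite inE yB' -(eqn_modDr t) -(cyclic_colouringX t cf yB') permKV.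
Qed.

Lemma colour_partition_porbit f : cyclic_colouring f ->
  colour_partition f = porbit (set_perm s) (colour_class f 0).
Proof.
move=> cf; apply/setP => b; apply/imsetP/porbitP => [[i _ ->]|[t ->]].
  by exists i; rewrite set_perm_colour_class.
exists (Ordinal (ltn_pmod t k_gt0)) => //=.
by rewrite set_perm_colour_class // add0n colour_class_mod.
Qed.

Lemma colour_partition_transitive f x0 : x0 \in cover B -> cyclic_colouring f ->
  transitive_partition s B (colour_partition f) /\ #|colour_partition f| = k.
Proof.
move=> x0B cf.
have class_neq0 i : exists x, x \in colour_class f i.
  exists ((s ^+ (i + (k - f x0 %% k)))%g x0); rewrite inE cover_permX x0B /=.
  rewrite cyclic_colouringX // -modnDml addnCA subnKC ?modnDr //.
  exact/ltnW/ltn_pmod.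
split; last first.
  rewrite card_imset ?card_ord // => i j e; have [x xi] := class_neq0 i.
  have := xi; rewrite e inE => /andP[_ /eqP]; move: xi; rewrite inE =>
    /andP[_ /eqP ->].
  by rewrite !modn_small // => /val_inj.
apply/andP; split; last first.
  apply/exists_inP; exists (colour_class f 0); first exact:
    mem_colour_partition.
  by rewrite colour_partition_porbit.
apply/and3P; split.
- apply/eqP/setP => x; apply/bigcupP/idP => [[_ /imsetP[i _ ->]]|xB].
    by rewrite inE => /andP[].
  by exists (colour_class f (f x)); rewrite ?mem_colour_partition // inE xB
    eqxx.
- apply/trivIsetP => _ _ /imsetP[i _ ->] /imsetP[j _ ->].
  apply: contraR => /pred0Pn[x /andP[]]; rewrite !inE =>
    /andP[_ /eqP fi] /andP[_ /eqP fj].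
  by apply/eqP; rewrite -colour_class_mod -fi fj colour_class_mod.
apply/negP => /imsetP[i _ e]; have [x] := class_neq0 i.
by rewrite -e inE.
Qed.

Lemma colour_partition_eq P f b0 : transitive_partition s B P -> #|P| = k ->
  b0 \in P -> (forall x, x \in cover B -> x \in (set_perm s ^+ f x)%g b0) ->
  colour_partition f = P.
Proof.
move=> trP Pk b0P fP; have Pb := transitive_porbit trP b0P.
have /andP[partP _] := trP; have tP := partition_trivIset partP.
have memP i : (set_perm s ^+ i)%g b0 \in P by rewrite Pb mem_porbit.
have classE i : colour_class f i = (set_perm s ^+ i)%g b0.
  apply/setP => x; rewrite inE -Pk Pb -permX_eq; apply/andP/idP =>
    [[xB /eqP <-]|xi].
    exact: fP.
  have xB : x \in cover B by rewrite -(cover_partition partP); apply/bigcupP;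
    exists ((set_perm s ^+ i)%g b0).
  split=> //; apply/eqP.
  by rewrite -(def_pblock tP (memP _) (fP x xB)) (def_pblock tP (memP _) xi).
apply/setP => b; apply/imsetP/idP => [[i _ ->]|]; first by rewrite classE.
rewrite {1}Pb => /porbitP[t ->]; exists (Ordinal (ltn_pmod t k_gt0)) => //.
by rewrite colour_class_mod classE.
Qed.

End Colouring.

Lemma card_transitive_partition k : B != set0 -> (0 < k)%N ->
  #|[set P | transitive_partition s B P && (#|P| == k)]|
    = if [forall c in B, (k %| #|c|)%N] then (k ^ (#|B| - 1))%N else 0%N.
Proof.
case/set0Pn=> c0 c0B k_gt0; case: ifPn => [/forall_inP dvdk|ndvd]; last first.
  apply: eq_card0 => P; rewrite inE; apply: contraNF ndvd => /andP[trP /eqP <-].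
  by apply/forall_inP => c; apply: transitive_dvd.
have /imsetP[z _ c0z] := subsetP subB _ c0B.
pose rep c := odflt z [pick y in c].
have rep_mem x : rep (porbit s x) \in porbit s x.
  by rewrite /rep; case: pickP => [//|/(_ x)]; rewrite porbit_id.
have [idx idxP] : exists idx : T -> nat, forall x, x = (s ^+ idx x)%g (rep
  (porbit s x)).
  apply: (@fin_all_exists _ (fun=> nat) (fun x i =>
    x = (s ^+ i)%g (rep (porbit s x)))) => x.
  by apply/porbitP; rewrite porbit_sym.
case: k k_gt0 dvdk => // k _ dvdk.
pose f (j : {ffun {set T} -> 'I_k.+1}) x := (j (porbit s x) + idx x)%N.
have idx_step x i : x \in cover B -> idx ((s ^+ i)%g x) = idx x + i %[mod k.+1].
  move=> xB; have dk : (k.+1 %| #|porbit s x|)%N by apply: dvdk;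
    rewrite -coverP.
  apply/eqP; rewrite -(modn_dvdm _ dk) -[X in _ == X](modn_dvdm _ dk).
  apply/eqP; congr (_ %% _)%N; apply/eqP.
  have -> : porbit s x = porbit s (rep (porbit s x)) by apply/esym/eqP;
    rewrite eq_porbit_mem.
  rewrite -permX_eq expgD permM -idxP.
  by have := idxP ((s ^+ i)%g x); rewrite porbit_perm => <-.
have f_cyc j : cyclic_colouring k.+1 (f j).
  move=> x xB; have := idx_step x 1%N xB; rewrite expg1 addn1 => e.
  rewrite /f -addnS -modnDmr e modnDmr.
  by have := porbit_perm s 1 x; rewrite expg1 => ->.
have rep_idx x : x \in cover B -> idx (rep (porbit s x)) = 0 %[mod k.+1].
  move=> xB; have rx : porbit s (rep (porbit s x)) = porbit s x by apply/eqP;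
    rewrite eq_porbit_mem.
  have rB : rep (porbit s x) \in cover B by rewrite coverP rx -coverP.
  apply/eqP; rewrite -(eqn_modDr (idx x)) add0n.
  by have /eqP := idx_step _ (idx x) rB; rewrite -idxP eq_sym.
pose x0 := rep c0; have x0c : porbit s x0 = c0 by apply/eqP;
  rewrite /x0 c0z eq_porbit_mem.
have x0B : x0 \in cover B by rewrite coverP x0c.
pose D := B :\ c0.
have jc0 (j : {ffun {set T} -> 'I_k.+1}) : j \in pffun_on ord0 (mem D) predT ->
  j c0 = ord0.
  by case/pffun_onP=> /supportP/(_ c0) -> //; rewrite !inE eqxx.
have fx0 j : j \in pffun_on ord0 (mem D) predT -> f j x0 = 0 %[mod k.+1].
  move/jc0; rewrite /f x0c => ->; rewrite add0n.
  by have := rep_idx x0 x0B; rewrite x0c.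
have cardD : #|D| = (#|B| - 1)%N by rewrite (cardsD1 c0 B) c0B addKn.
have repB c : c \in B -> porbit s (rep c) = c /\ rep c \in cover B.
  move=> cB; have /imsetP[x _ cx] := subsetP subB _ cB.
  have rc : porbit s (rep c) = c by apply/eqP; rewrite cx eq_porbit_mem.
  by rewrite coverP rc.
have f_rep (j : {ffun {set T} -> 'I_k.+1}) c :
  c \in B -> f j (rep c) = j c %[mod k.+1].
  move=> /repB[rc rB]; rewrite /f -modnDmr.
  by have := rep_idx _ rB; rewrite rc => ->; rewrite modnDmr addn0.
have fx0X j i : j \in pffun_on ord0 (mem D) predT -> f j ((s ^+ i)%g x0) = i
  %[mod k.+1].
  by move=> jD; rewrite (cyclic_colouringX _ (f_cyc _)) // -modnDml fx0 //
    modnDml.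
transitivity #|[set colour_partition k.+1 (f j) | j in pffun_on ord0 (mem D)
  predT]|; last first.
  rewrite card_in_imset ?card_pffun_on ?card_ord ?cardD // => j j' jD j'D e.
  apply/ffunP => c; have [cD|ncD] := boolP (c \in D); last first.
    by have [/pffun_onP[/supportP-> // _] /pffun_onP[/supportP-> // _]] := (jD,
      j'D).
  have cB : c \in B by case/setD1P: cD.
  have [_ rB] := repB c cB.
  have : colour_class k.+1 (f j) (j c) \in colour_partition k.+1 (f j').
    by rewrite -e mem_colour_partition.
  case/imsetP=> i _ /setP ei.
  have /esym := ei (rep c); rewrite !inE rB !f_rep // eqxx /= => /eqP h1.
  have /esym := ei ((s ^+ j c)%g x0); rewrite !inE cover_permX x0B.
  rewrite !fx0X // eqxx /= => /eqP h2.
  by apply/val_inj; move: h1; rewrite -h2 !modn_small.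
apply: eq_card => P; rewrite inE; apply/andP/imsetP =>
  [[trP /eqP Pk]|[j _ ->]]; last first.
  by have [//|-> ->] := colour_partition_transitive _ x0B (f_cyc j).
have /andP[partP _] := trP; have tP := partition_trivIset partP.
have : x0 \in cover P by rewrite (cover_partition partP).
case/bigcupP=> b0 b0P x0b0; have Pb := transitive_porbit trP b0P.
have bk : #|porbit (set_perm s) b0| = k.+1 by rewrite -Pb.
have memP i : (set_perm s ^+ i)%g b0 \in P by rewrite Pb mem_porbit.
have [t tP'] : exists t : T -> nat, forall x, x \in cover B -> x \in (set_perm
  s ^+ t x)%g b0.
  apply: (@fin_all_exists _ (fun=> nat) (fun x i =>
    x \in cover B -> x \in (set_perm s ^+ i)%g b0)) => x.
  have [|nxB] := boolP (x \in cover B); last by exists 0%N.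
  rewrite -(cover_partition partP) => /bigcupP[b]; rewrite {1}Pb =>
    /porbitP[i ->].
  by exists i.
pose j : {ffun {set T} -> 'I_k.+1} :=
  [ffun c => if c \in D then inord (t (rep c) %% k.+1) else ord0].
exists j.
  by apply/pffun_onP; split=> //; apply/supportP => c nc;
    rewrite ffunE (negbTE nc).
have jt c : c \in B -> j c = t (rep c) %[mod k.+1].
  move=> cB; rewrite ffunE !inE cB andbT; have [->|_] /= := eqVneq c c0;
    last first.
    by rewrite inordK ?ltn_pmod // modn_mod.
  apply/eqP; rewrite -bk -permX_eq expg0 perm1; apply/eqP.
  exact: etrans (esym (def_pblock tP b0P x0b0)) (def_pblock tP (memP _) (tP' _
    x0B)).
apply/esym/(colour_partition_eq _ trP Pk b0P) => // x xB.
have cB : porbit s x \in B by rewrite -coverP.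
have [_ rB] := repB _ cB.
have -> : (set_perm s ^+ f j x)%g b0 = (set_perm s ^+ (t (rep (porbit s x)) +
  idx x))%g b0.
  by apply/eqP; rewrite permX_eq bk /f -modnDml jt // modnDml.
rewrite expgD permM set_permX [X in X \in _]idxP imset_f //.
exact: tP'.
Qed.

End Counting.

Section OrbitWeights.
Variables (n : nat) (s : 'S_n).
Implicit Types (P : {set {set 'I_n}}) (B : {set {set 'I_n}}) (S :
  {set {set {set 'I_n}}}).

Lemma porbits_partition : partition (porbits s) [set: 'I_n].
Proof.
apply/and3P; split.
- by apply/eqP/setP => x; rewrite (@mem_cover_porbits _ s) // inE mem_porbits.
- apply/trivIsetP => c c' cs cs'; apply: contraR =>
  /pred0Pn[x /andP[/= xc xc']].
  by rewrite -(porbit_porbits cs xc) (porbit_porbits cs' xc').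
by apply/negP => /imsetP[x _ /setP/(_ x)]; rewrite porbit_id inE.
Qed.

Definition orbit_weight B P : {poly rat} :=
  (-1) ^+ (#|cover B| + #|P| + #|B| + 1) *: 'X^(#|cover B| - #|P|).

Lemma card_cover_porbits B : B \subset porbits s -> #|cover B| = (\sum_(c in B)
  #|c|)%N.
Proof.
move=> sB; apply/esym/eqP.
by apply: trivIsetS sB _; apply: partition_trivIset porbits_partition.
Qed.

Lemma cover_cycle_quot B k : B \subset porbits s -> [forall c in B, (k %|
  #|c|)%N] ->
  (k * \sum_(c in B) cycle_quot k c)%N = #|cover B|.
Proof.
move=> sB /forall_inP dv; rewrite card_cover_porbits // big_distrr /=.
by apply: eq_bigr => c cB; rewrite /cycle_quot mulnC divnK // dv.
Qed.

Lemma sign_exponent k d e b : (0 < k)%N -> (0 < d)%N -> (e + b)%N = d ->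
  (k * d + k + b + 1 = (k - 1) * (d - 1) + e + 2 * (k + b))%N.
Proof. by case: k => // k _; case: d => // d _; nia. Qed.

Lemma sum_transitive_partitions B : B \subset porbits s -> B != set0 ->
  \sum_(P | transitive_partition s B P) orbit_weight B P =
  \sum_(1 <= k < n.+1 | [forall tau in B, (k %| #|tau|)%N])
          (epsilon B k * k%:R ^+ (#|B| - 1)%N)
            *: 'X^(k * ((\sum_(tau in B) cycle_quot k tau) - 1))%N.
Proof.
move=> sB nB; rewrite big_geq_mkord.
have [c cB] := set0Pn _ nB.
have cycle_gt0 t : t \in B -> (0 < #|t|)%N.
  by move/(subsetP sB)/imsetP => [x _ ->]; rewrite lt0n card_porbit_neq0.
have leP P : transitive_partition s B P -> (0 < #|P| <= n)%N.
  move=> trP; have := transitive_dvd sB trP cB => dv; apply/andP; split.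
    by rewrite card_gt0; apply/set0Pn; have /andP[_ /exists_inP[b bP _]] :=
      trP; exists b.
  by apply: leq_trans (dvdn_leq (cycle_gt0 _ cB) dv) _;
    rewrite -[n in (_ <= n)%N]card_ord max_card.
rewrite (partition_big (fun P => inord #|P| : 'I_n.+1)
  (fun k : 'I_n.+1 => [forall tau in B, (k %| #|tau|)%N] && (0 < k)%N)) /=;
    last first.
  move=> P trP; have /andP[P0 Pn] := leP P trP; rewrite inordK // P0 andbT.
  by apply/forall_inP => t tB; apply: transitive_dvd trP tB.
apply: eq_bigr => k /andP[dv k_gt0].
transitivity (\sum_(P in [set P | transitive_partition s B P && (#|P| == k)])
    (epsilon B k *: 'X^(k * ((\sum_(tau in B) cycle_quot k tau) - 1))%N :
      {poly rat})); last first.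
  by rewrite sumr_const card_transitive_partition // dv -natrX mulr_natr
    scalerMnl.
apply: eq_big => [P|P /andP[trP /eqP ek]].
  rewrite inE; case trP: (transitive_partition _ _ _) => //=.
  by have /andP[_ Pn] := leP P trP; rewrite -val_eqE /= inordK.
have {ek} Pk : #|P| = k by have /andP[_ Pn] := leP P trP; rewrite -ek inordK.
have kD := cover_cycle_quot sB dv.
set D := (\sum_(c in B) cycle_quot k c)%N in kD *.
have quot_gt0 t : t \in B -> (0 < cycle_quot k t)%N.
  move=> tB; rewrite /cycle_quot divn_gt0 // dvdn_leq ?cycle_gt0 //.
  by move/forall_inP: dv; apply.
have E : (\sum_(t in B) (cycle_quot k t - 1) + #|B|)%N = D.
  rewrite -sum1_card -big_split /=; apply: eq_bigr => t tB.
  by rewrite subnK // quot_gt0.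
have D_gt0 : (0 < D)%N by rewrite /D (bigD1 c) //= addn_gt0 quot_gt0.
rewrite /orbit_weight Pk -kD; congr (_ *: 'X^_); last by rewrite mulnBr muln1.
rewrite /epsilon -/D.
set e := (\sum_(t in B) _)%N in E *.
have -> : (k * D + k + #|B| + 1 = (k - 1) * (D - 1) + e + 2 * (k + #|B|))%N.
  exact: sign_exponent.
by rewrite -signr_odd oddD (oddM 2) addbF signr_odd.
Qed.

Lemma prod_orbit_weight P : invariant_partition s P ->
  \prod_(B in merged_cycles s P) orbit_weight B (P ::&: cover B)
  = (-1) ^+ (n + #|P| + #|porbits s| + #|merged_cycles s P|) *: 'X^(n - #|P|).
Proof.
move=> invP; have partS := merged_cycles_partition invP;
  set S := merged_cycles s P in partS *.
have subS B : B \in S -> B \subset porbits s by apply: partitionS.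
have cov : (\sum_(B in S) #|cover B|)%N = n.
  rewrite (eq_bigr (fun B => \sum_(c in B) #|c|)%N) => [|B BS];
    last exact/card_cover_porbits/subS.
  by rewrite -(set_partition_big _ partS) -(card_partition porbits_partition)
    cardsT card_ord.
have cardP : (\sum_(B in S) #|P ::&: cover B|)%N = #|P|.
  rewrite -[in RHS](merged_bigcup invP) -/S [in RHS]big_mkcond -sum1_card.
  rewrite partition_disjoint_bigcup => [|B B' nBB'].
    rewrite [LHS]big_mkcond; apply: eq_bigr => B _.
    by case: ifP => _; rewrite sum1_card ?cards0.
  apply: contraR nBB' => /pred0Pn[b /andP[/=]].
  case: ifPn => BS; rewrite ?inE // => /andP[bP /subsetP sb].
  case: ifPn => B'S; rewrite ?inE // => /andP[_ /subsetP sb'].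
  have [x xb] := invariant_neq0 invP bP.
  have := sb x xb; rewrite (@mem_cover_porbits _ s) ?subS // => xB.
  have := sb' x xb; rewrite (@mem_cover_porbits _ s) ?subS // => xB'.
  have tS := partition_trivIset partS.
  by rewrite -(def_pblock tS BS xB) (def_pblock tS B'S xB').
rewrite /orbit_weight scaler_prod !prodrXr !big_split /= cov cardP sum1_card.
rewrite -(card_partition partS) sumnB ?cov ?cardP //.
move=> B BS.
have trB := merged_transitive invP BS.
have [c cB] : exists c, c \in B by apply/set0Pn; apply: (partition_neq0 partS).
apply: leq_trans (dvdn_leq _ (transitive_dvd (subS _ BS) trB cB)) _.
  by have /imsetP[x _ ->] := subsetP (subS _ BS) _ cB;
    rewrite lt0n card_porbit_neq0.
exact/subset_leq_card/(bigcup_sup c).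
Qed.
End OrbitWeights.

(** * Stable partitions as idempotent functions *)

Section Fibres.
Variable n : nat.
Implicit Types (f : {ffun 'I_n -> 'I_n}) (s : 'S_n) (P : {set {set 'I_n}}).

Definition fibre f p := [set y | f y == p].
Definition fibres f := [set fibre f p | p in [set x | f x == x]].

Definition block_min P : {ffun 'I_n -> 'I_n} :=
  [ffun x => [arg min_(y < x in pblock P x) y]].

Lemma fibre_root f p : f p = p -> p \in fibre f p.
Proof. by move=> fp; rewrite inE fp. Qed.

Lemma fibre_inj f p q : f p = p -> fibre f p = fibre f q -> p = q.
Proof. by move=> fp /setP/(_ p); rewrite !inE fp eqxx => /esym/eqP. Qed.

Lemma card_fibres f : (#|fibres f| + size (nonroots f))%N = n.
Proof.
rewrite card_in_imset => [|p q]; last by rewrite inE => /eqP fp _; apply: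
  fibre_inj.
exact: card_roots.
Qed.

Lemma fibres_partition f : (forall x, f (f x) = f x) -> partition (fibres f)
  [set: 'I_n].
Proof.
move=> ff; apply/and3P; split.
- apply/eqP/setP => x; rewrite inE; apply/bigcupP.
  by exists (fibre f (f x)); rewrite ?inE ?eqxx // imset_f // inE ff.
- apply/trivIsetP => _ _ /imsetP[p _ ->] /imsetP[q _ ->].
  by apply: contraR => /pred0Pn[x /andP[]]; rewrite !inE => /eqP-> /eqP->.
apply/negP => /imsetP[p]; rewrite inE => /eqP fp /setP/(_ p).
by rewrite fibre_root // inE.
Qed.

Lemma block_minP P x : partition P [set: 'I_n] ->
  block_min P x \in pblock P x /\ forall y, y \in pblock P x -> (block_min P x
    <= y)%N.
Proof.
move=> partP; rewrite ffunE; case: arg_minnP => //.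
by rewrite mem_pblock (cover_partition partP) inE.
Qed.

Lemma block_min_eq P x y : partition P [set: 'I_n] -> y \in pblock P x ->
  block_min P y = block_min P x.
Proof.
move=> partP yx; have e := same_pblock (partition_trivIset partP) yx.
have [x1 x2] := block_minP x partP; have [y1 y2] := block_minP y partP.
rewrite e in y1 y2; apply/val_inj/eqP.
by rewrite eqn_leq y2 // x2.
Qed.

Lemma block_min_rep P : partition P [set: 'I_n] -> min_rep (block_min P).
Proof.
move=> partP; apply/min_repP; split=> x; have [h1 h2] := block_minP x partP.
  exact: block_min_eq.
by apply: h2; rewrite mem_pblock (cover_partition partP) inE.
Qed.

Lemma block_minK P : partition P [set: 'I_n] -> fibres (block_min P) = P.
Proof.
move=> partP; have tP := partition_trivIset partP.
have fib x : fibre (block_min P) (block_min P x) = pblock P x.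
  apply/setP => y; rewrite inE; apply/eqP/idP => [e|]; last exact: block_min_eq.
  have [y1 _] := block_minP y partP; have [x1 _] := block_minP x partP.
  rewrite e in y1; rewrite -(same_pblock tP x1) (same_pblock tP y1) mem_pblock.
  by rewrite (cover_partition partP) inE.
apply/setP => b; apply/imsetP/idP => [[p]|bP].
  rewrite inE => /eqP <- ->; rewrite fib pblock_mem //.
  by rewrite (cover_partition partP) inE.
have [x xb] := set0Pn _ (partition_neq0 partP bP).
have [/min_repP[gg _] _] := (block_min_rep partP, tt).
exists (block_min P x); rewrite ?inE ?gg // fib.
by rewrite (def_pblock tP bP xb).
Qed.

Lemma fibresK f : min_rep f -> block_min (fibres f) = f.
Proof.
case/min_repP=> ff fle; have partP := fibres_partition ff.
apply/ffunP => x; have [h1 h2] := block_minP x partP.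
have e : pblock (fibres f) x = fibre f (f x).
  apply: def_pblock (partition_trivIset partP) _ _; last by rewrite inE.
  by rewrite imset_f // inE ff.
rewrite e in h1 h2; apply/val_inj/eqP; rewrite eqn_leq h2 ?inE ?ff //=.
by move: h1; rewrite inE => /eqP <-; apply: fle.
Qed.

Section Stable.
Variables (f : {ffun 'I_n -> 'I_n}) (s : 'S_n).
Hypothesis ff : forall x, f (f x) = f x.

Lemma set_perm_fibre : (forall x, f (s x) = f (s (f x))) ->
  forall p, f p = p -> set_perm s (fibre f p) = fibre f (f (s p)).
Proof.
move=> fs p fp; rewrite permE; apply/setP => y; apply/imsetP/idP => [[x]|].
  by rewrite !inE => /eqP fx ->; rewrite fs fx.
rewrite inE => /eqP fy; exists ((s^-1)%g y); last by rewrite permKV.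
rewrite inE; apply/eqP/(perm_root_inj ff fs) => //.
by rewrite -fs permKV.
Qed.

Lemma fibres_invariant : invariant_partition s (fibres f) = [forall x, f (s x)
  == f (s (f x))].
Proof.
apply/andP/forallP => [[_ /forall_inP h] x|h].
  have : set_perm s (fibre f (f x)) \in fibres f by apply: h;
    rewrite imset_f // inE ff.
  case/imsetP=> q _; rewrite permE => /setP e.
  have := e (s x); have := e (s (f x)).
  rewrite !imset_f ?inE ?ff // => /esym/eqP-> /esym/eqP->.
  by rewrite eqxx.
have fs x : f (s x) = f (s (f x)) by apply/eqP; apply: h.
split; first exact: fibres_partition.
apply/forall_inP => b /imsetP[p]; rewrite inE => /eqP fp ->.
by rewrite set_perm_fibre // imset_f // inE ff.
Qed.

Variable R : 'S_n.
Hypothesis fs : forall x, f (s x) = f (s (f x)).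
Hypothesis RE : forall x, R x = if f x == x then f (s x) else x.

Let roots := [set x | f x == x].

Let rootX p i : f p = p -> f ((R ^+ i)%g p) = (R ^+ i)%g p.
Proof.
move=> fp; elim: i => [|i IHi]; first by rewrite expg0 perm1.
by rewrite expgSr permM RE IHi eqxx ff.
Qed.

Let fibreX p i : f p = p -> (set_perm s ^+ i)%g (fibre f p) = fibre f ((R ^+
  i)%g p).
Proof.
move=> fp; elim: i => [|i IHi]; first by rewrite !expg0 !perm1.
by rewrite !expgSr !permM IHi set_perm_fibre ?rootX // RE rootX // eqxx.
Qed.

Lemma card_merged_cycles : invariant_partition s (fibres f) ->
  #|merged_cycles s (fibres f)| = #|porbit R @: roots|.
Proof.
move=> invP; transitivity #|porbit (set_perm s) @: fibres f|.
  apply: card_in_imset => _ _ /imsetP[b bP ->] /imsetP[b' b'P ->] /(congr1 (fun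
    S => fibres f ::&: cover S)).
  by rewrite !cover_merged !(merged_orbit invP).
have -> : porbit (set_perm s) @: fibres f = (fun O : {set 'I_n} => fibre f @:
  O) @: (porbit R @: roots).
  rewrite -!imset_comp; apply: eq_in_imset => p; rewrite inE => /eqP fp /=.
  apply/setP => b; apply/porbitP/imsetP => [[i ->]|[q /porbitP[i ->] ->]].
    by exists ((R ^+ i)%g p); rewrite ?mem_porbit // fibreX.
  by exists i; rewrite fibreX.
apply: card_in_imset => _ _ /imsetP[p + ->] /imsetP[q + ->].
rewrite !inE => /eqP fp /eqP fq /setP/(_ (fibre f p)).
rewrite imset_f ?porbit_id // => /esym/imsetP[_ /porbitP[i ->]].
by move/(fibre_inj fp) => ->; rewrite porbit_perm.
Qed.

Lemma card_porbits_root_perm :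
  #|porbits R| = (#|porbit R @: roots| + size (nonroots f))%N.
Proof.
have fixX x i : f x != x -> (R ^+ i)%g x = x.
  move=> fx; elim: i => [|i IHi]; first by rewrite expg0 perm1.
  by rewrite expgSr permM IHi RE (negbTE fx).
have -> : porbits R = (porbit R @: roots) :|: (porbit R @: ~: roots).
  by rewrite -imsetU setUCr; apply/setP => O; apply/imsetP/imsetP => -[x _ ->];
    exists x; rewrite ?inE.
rewrite cardsU [X in (_ - X)%N](_ : _ = 0%N) ?subn0; last first.
  apply/eqP; rewrite cards_eq0; apply/eqP/setP => O; rewrite !inE; apply/negP.
  case/andP=> /imsetP[p + ->] /imsetP[x]; rewrite !inE => /eqP fp fx e.
  have : x \in porbit R p by rewrite e porbit_id.
  by case/porbitP=> i ex; rewrite ex rootX ?eqxx in fx.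
congr (_ + _)%N; rewrite card_in_imset => [|x y].
  by rewrite -(card_uniqP (nonroots_uniq f)); apply: eq_card => x;
    rewrite !inE mem_nonroots.
rewrite !inE => _ fy e; have : x \in porbit R y by rewrite -e porbit_id.
by case/porbitP=> i ->; apply: fixX.
Qed.

Lemma root_perm_sign : invariant_partition s (fibres f) ->
  (-1) ^+ R * (-1) ^+ s
    = (-1) ^+ (n + #|fibres f| + #|porbits s| + #|merged_cycles s (fibres f)|)
      :> rat.
Proof.
move=> invP; rewrite /odd_perm card_ord -!signr_addb -[RHS]signr_odd;
  congr (_ ^+ nat_of_bool _).
rewrite card_porbits_root_perm -(card_merged_cycles invP).
have := congr1 odd (card_fibres f); rewrite !oddD => <-.
by do 4!case: (odd _).
Qed.

End Stable.

Lemma pfb_dual_char_partitions s m : pfb_dual_char s m =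
  \sum_(P | invariant_partition s P && (n - #|P| == m)%N)
    (-1) ^+ (n + #|P| + #|porbits s| + #|merged_cycles s P|).
Proof.
rewrite (reindex_onto fibres block_min) => [|P /andP[/andP[partP _] _]];
  last exact: block_minK.
rewrite pfb_dual_charE (bigID (fun f => [forall x, f (s x) == f (s (f x))])) /=.
rewrite [X in _ + X]big1 ?addr0 => [|f /andP[_ /negbTE nf]];
  last by rewrite star_coef_perm nf !mul0r.
apply: eq_big => [f|f /andP[+ /forallP fs]]; last first.
  rewrite inE => /andP[mf _]; have [ff _] := min_repP _ mf.
  have fs' x : f (s x) = f (s (f x)) by apply/eqP.
  have [R RE ->] := star_coef_star_perm mf fs'.
  apply: root_perm_sign => //; rewrite fibres_invariant //; exact/forallP.
have cf : (n - #|fibres f|)%N = size (nonroots f) by rewrite -{1}(card_fibres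
  f) addKn.
rewrite inE cf; apply/andP/andP => [[/andP[mf ->] fs]|[/andP[invP ->] /eqP fK]].
  by have [ff _] := min_repP _ mf; rewrite fibres_invariant // fs fibresK.
have mf : min_rep f by rewrite -fK; apply: block_min_rep; case/andP: invP.
by have [ff _] := min_repP _ mf; rewrite mf -fibres_invariant.
Qed.

End Fibres.

Theorem theorem15 (n : nat) (sigma : 'S_n) (m : nat) :
  pfb_dual_char sigma m =
  (\sum_(S : {set {set {set 'I_n}}} | partition S (porbits sigma))
     \prod_(B in S)
       \sum_(1 <= k < n.+1 | [forall tau in B, (k %| #|tau|)%N])
          (epsilon B k * k%:R ^+ (#|B| - 1)%N)
            *: 'X^(k * ((\sum_(tau in B) cycle_quot k tau) - 1))%N)`_m.
Proof.
transitivity (\sum_(P | invariant_partition sigma P)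
  \prod_(B in merged_cycles sigma P) orbit_weight B (P ::&: cover B))`_m.
  rewrite coef_sum pfb_dual_char_partitions big_mkcondr; apply: eq_bigr =>
    P invP.
  rewrite prod_orbit_weight // coefZ coefXn eq_sym.
  by case: eqP; rewrite ?mulr1 ?mulr0.
congr ((_ : {poly rat})`_m); rewrite (sum_invariant_partitions sigma
  (@orbit_weight n)).
apply: eq_bigr => S partS; apply: eq_bigr => B BS.
apply: sum_transitive_partitions; first exact: partitionS partS BS.
exact: partition_neq0 partS BS.
Qed.
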